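(* Let $(S,P)$ be a pair of commuting bounded operators on a Hilbert space $\mathcal H$. The following are equivalent: (1) $(S,P)$ is a $\Gamma$-unitary; (2) there exist commuting unitary operators $U_1$ and $U_2$ on $\mathcal H$ such that $S=U_1+U_2$ and $P=U_1U_2$; (3) $P$ is unitary, $S=S^*P$, and $r(S)\le2$, where $r(S)$ is the spectral radius of $S$; (4) $(S,P)$ is a $\Gamma$-contraction and $P$ is a unitary; (5) $P$ is a unitary and $S=U+U^*P$ for some unitary $U$ on $\mathcal H$ commuting with $P$.
   Context: All Hilbert spaces are complex and separable. Let $\Gamma=\{(z_1+z_2,z_1z_2):|z_1|\le 1,|z_2|\le 1\}\subset\mathbb C^2$ and $b\Gamma=\{(z_1+z_2,z_1z_2):|z_1|=|z_2|=1\}$. A $\Gamma$-contraction is a pair $(S,P)$ of commuting bounded operators such that $\|f(S,P)\|\le\sup_{\Gamma}|f|$ for every polynomial $f$ in two variables. A $\Gamma$-unitary is a commuting pair of normal operators whose (Taylor) joint spectrum is contained in $b\Gamma$. *)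

(* Defs.v *)
From HB Require Import structures.
From mathcomp Require Import all_boot all_order all_algebra.
From mathcomp Require Import all_classical all_reals all_analysis.
From mathcomp Require Import complex.

Set Implicit Arguments.
Unset Strict Implicit.
Unset Printing Implicit Defensive.

Import Order.TTheory GRing.Theory Num.Theory.
Import numFieldNormedType.Exports.

Local Open Scope classical_set_scope.
Local Open Scope ring_scope.

Definition separable (T : topologicalType) : Prop :=
  exists2 A : set T, countable A & dense A.

(* A complex Hilbert space is a complete normed space [H] over [R[i]] with an
   inner product (linear in its first argument) inducing the norm of [H]. *)
Definition induces_norm (R : realType) (H : completeNormedModType R[i])
    (dot : {dot H for Num.conj}) : Prop :=
  forall x : H, `|x| ^+ 2 = dot x x.

(* Norms over [R[i]] are [R[i]]-valued (with zero imaginary part). *)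
Definition enorm (R : realType) (V : normedZmodType R[i]) (x : V) : \bar R :=
  (complex.Re `|x|)%:E.

Definition bounded_op (R : realType) (H : normedModType R[i])
    (T : {linear H -> H}) : Prop :=
  bounded_near T (nbhs (0 : H)).

Definition opnorm (R : realType) (H : normedModType R[i]) (T : H -> H) :
    \bar R :=
  ereal_sup [set enorm (T x) | x in [set x : H | `|x| <= 1]].

Definition commute_op (T : Type) (A B : T -> T) : Prop := A \o B =1 B \o A.

(* [adjoint dot T y] is the vector [z] with <T x, y> = <x, z> for all [x];
   for bounded [T] it exists by the Riesz representation theorem, and it is
   unique because [dot] is definite. *)
Definition adjoint (R : realType) (H : normedModType R[i])
    (dot : {dot H for Num.conj}) (T : H -> H) (y : H) : H :=
  xget 0 [set z | forall x, dot (T x) y = dot x z].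

Definition normal_op (R : realType) (H : normedModType R[i])
    (dot : {dot H for Num.conj}) (T : {linear H -> H}) : Prop :=
  bounded_op T /\ adjoint dot T \o T =1 T \o adjoint dot T.

Definition unitary_op (R : realType) (H : normedModType R[i])
    (dot : {dot H for Num.conj}) (T : {linear H -> H}) : Prop :=
  [/\ bounded_op T, adjoint dot T \o T =1 id & T \o adjoint dot T =1 id].

Definition shift_op (R : realType) (H : lmodType R[i]) (T : H -> H)
    (l : R[i]) (x : H) : H :=
  T x - l *: x.

Definition spectrum (R : realType) (H : normedModType R[i]) (T : H -> H) :
    set R[i] :=
  [set l | ~ exists2 V : {linear H -> H}, bounded_op V &
             V \o shift_op T l =1 id /\ shift_op T l \o V =1 id].

(* The supremum is taken in the extended reals: it is [-oo] on the zero space,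
   the only one on which a bounded operator has an empty spectrum. *)
Definition spectral_radius (R : realType) (H : normedModType R[i])
    (T : H -> H) : \bar R :=
  ereal_sup [set enorm l | l in spectrum T].

(* Koszul complex 0 -> H -> H * H -> H -> 0 of a commuting pair (A, B). *)
Definition koszul0 (R : realType) (H : lmodType R[i]) (A B : H -> H) (x : H) :
    H * H :=
  (A x, B x).

Definition koszul1 (R : realType) (H : lmodType R[i]) (A B : H -> H)
    (u : H * H) : H :=
  A u.2 - B u.1.

Definition koszul_exact (R : realType) (H : lmodType R[i]) (A B : H -> H) :
    Prop :=
  [/\ koszul0 A B @^-1` [set 0] = [set 0],
      range (koszul0 A B) = koszul1 A B @^-1` [set 0] &
      range (koszul1 A B) = setT].

Definition taylor_spectrum (R : realType) (H : lmodType R[i]) (S P : H -> H) :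
    set (R[i] * R[i]) :=
  [set l | ~ koszul_exact (shift_op S l.1) (shift_op P l.2)].

Definition Gamma (R : realType) : set (R[i] * R[i]) :=
  [set (z.1 + z.2, z.1 * z.2) | z in
    [set z : R[i] * R[i] | `|z.1| <= 1 /\ `|z.2| <= 1]].

Definition bGamma (R : realType) : set (R[i] * R[i]) :=
  [set (z.1 + z.2, z.1 * z.2) | z in
    [set z : R[i] * R[i] | `|z.1| = 1 /\ `|z.2| = 1]].

(* A polynomial in two variables is an [f : {poly {poly R[i]}}]: the outer
   variable stands for the first argument, the inner one for the second. *)
Definition poly2_eval (R : realType) (f : {poly {poly R[i]}})
    (w : R[i] * R[i]) : R[i] :=
  f.[w.1%:P].[w.2].

Definition poly2_op (R : realType) (H : lmodType R[i])
    (f : {poly {poly R[i]}}) (S P : H -> H) (x : H) : H :=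
  \sum_(i < size f) \sum_(j < size f`_i)
    f`_i`_j *: iter i S (iter j P x).

Definition Gamma_contraction (R : realType) (H : normedModType R[i])
    (S P : {linear H -> H}) : Prop :=
  [/\ bounded_op S, bounded_op P, commute_op S P &
      forall f : {poly {poly R[i]}},
        (opnorm (poly2_op f S P) <=
           ereal_sup [set enorm (poly2_eval f w) | w in @Gamma R])%E].

Definition Gamma_unitary (R : realType) (H : normedModType R[i])
    (dot : {dot H for Num.conj}) (S P : {linear H -> H}) : Prop :=
  [/\ normal_op dot S, normal_op dot P, commute_op S P &
      taylor_spectrum S P `<=` @bGamma R].

(* Main.v *)
Require Import Defs.
From HB Require Import structures.
From mathcomp Require Import all_boot all_order all_algebra.
From mathcomp Require Import all_classical all_reals all_analysis.
From mathcomp Require Import complex ring lra.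

(** All five conditions amount to three relations [gamma_relations]: [P] is
    unitary, [S = adj S * P] and the norm of [S] is at most 2.

    From the relations to pairs of unitaries [unitary_summand].  Let [V] be a
    unitary square root of [P] which commutes with every operator commuting
    with [P].  Then [A = S * adj V / 2] is a selfadjoint contraction,
    [W = A + i sqrt (1 - A * A)] is unitary, and [U = V * W] satisfies
    [S = U + adj U * P].  So [S] is the sum, and [P] the product, of the
    commuting unitaries [U] and [adj U * P].

    From pairs of unitaries back.  If [S = U + V] and [P = U * V], the
    relations are immediate [sum_relations].  If [(s, p)] is not in [bGamma],
    write [s = z + w] and [p = z * w] with [z] off the unit circle; then
    [(P - p) - z (S - s) = (U - z) (V - z)] is invertible, and this makes the
    Koszul complex of [(S - s, P - p)] exact [taylor_spectrum_unitaries].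

    From the spectral conditions to the relations.  The tool is
    [joint_eigenvectors]: for commuting normal operators [S], [P] and an
    operator [T] in their algebra with [m |x| < |T x|] for some [x], there is
    a sequence of unit vectors, approximate eigenvectors of [S], [P] and their
    adjoints, along which the norm of [T] stays above some [r > m].  Hence a
    function of [S] and [P] is bounded in norm by its supremum over the joint
    approximate spectrum [joint_spectrum_bound].
    - Joint approximate eigenvalues belong to the Taylor spectrum, because the
      last map of the Koszul complex cannot be onto at such a point
      [approx_eigen_taylor].  If the Taylor spectrum lies in [bGamma], the
      relations hold at every joint approximate eigenvalue, hence for the
      operators.  That [S] commutes with [adj P] is Fuglede's theorem.
    - Under the condition on the spectral radius only the bound on the norm of
      [S] is missing; it holds at every approximate eigenvalue of [S].
    - Given the relations, joint approximate eigenvalues lie in [bGamma], so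
      polynomials in [(S, P)] are bounded by their supremum on [bGamma]
      [von_neumann], and [(S, P)] is a Gamma-contraction.
    - For a Gamma-contraction with [P] unitary, the polynomials
      [p + e (w s p - conj w s)], where [w] is a unimodular constant, have
      modulus at most [1 + O(e^2)] on [Gamma]; the terms of first order in [e]
      in the resulting operator inequality give [S = adj S * P]
      [gamma_bounded_relations].

    The spectral projections which drive [joint_eigenvectors], Fuglede's
    theorem and the square root of [P] are obtained by hand: square roots by
    a norm-convergent iteration [sqrt_exists], projections onto kernels from
    the projection theorem [kernel_projection], and the projection of [A] onto
    its nonnegative part as the kernel of [|A| - A] [spectral_projection]. *)

Set Implicit Arguments.
Unset Strict Implicit.
Unset Printing Implicit Defensive.

Import Order.TTheory GRing.Theory Num.Theory.
Import numFieldNormedType.Exports.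

Local Open Scope classical_set_scope.
Local Open Scope ring_scope.
Local Open Scope complex_scope.

(** * The real inner product of a complex Hilbert space *)

(** One argument carries the space and its inner product, so that the inner
    product is inferred from the type of the vectors. *)
Record hilbert (R : realType) := Hilbert {
  hcarrier :> completeNormedModType R[i];
  hdot : {dot hcarrier for Num.conj};
  hdotP : induces_norm hdot }.
Arguments hdot {R h}.
Arguments hdotP {R h}.

Section InnerProduct.
Variables (R : realType) (H : hilbert R).
Implicit Types (x y z : H) (r : R) (c : R[i]).

Definition nrm x : R := complex.Re `|x|.
(** The real part of the inner product has the same norm as the inner product,
    and, for complex-linear operators, the same adjoints; its values lie in an
    ordered field. *)
Definition ip x y : R := complex.Re (hdot x y).

Lemma normE x : `|x| = (nrm x)%:C.
Proof. by rewrite /nrm RRe_real // ger0_real. Qed.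

Lemma nrm_ge0 x : 0 <= nrm x.
Proof. by rewrite -ler0c -normE. Qed.

Lemma dotC x y : hdot x y = Num.conj (hdot y x).
Proof. by rewrite hermC expr0 mul1r. Qed.

Lemma Re_conj c : complex.Re (Num.conj c) = complex.Re c.
Proof. by case: c. Qed.

Lemma Re_realM r c : complex.Re (r%:C * c) = r * complex.Re c.
Proof. by case: c => a b /=; rewrite mul0r subr0. Qed.

Lemma ipC x y : ip x y = ip y x.
Proof. by rewrite /ip dotC Re_conj. Qed.

Lemma ipDl x y z : ip (x + y) z = ip x z + ip y z.
Proof. by rewrite /ip linearDl raddfD. Qed.

Lemma ipDr x y z : ip x (y + z) = ip x y + ip x z.
Proof. by rewrite ipC ipDl !(ipC x). Qed.

Lemma ipNl x y : ip (- x) y = - ip x y.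
Proof. by rewrite /ip linearNl raddfN. Qed.

Lemma ipNr x y : ip x (- y) = - ip x y.
Proof. by rewrite ipC ipNl ipC. Qed.

Lemma ipBl x y z : ip (x - y) z = ip x z - ip y z.
Proof. by rewrite ipDl ipNl. Qed.

Lemma ipBr x y z : ip x (y - z) = ip x y - ip x z.
Proof. by rewrite ipDr ipNr. Qed.

Lemma ipZl r x y : ip (r%:C *: x) y = r * ip x y.
Proof. by rewrite /ip linearZl_LR /= Re_realM. Qed.

Lemma ipZr r x y : ip x (r%:C *: y) = r * ip x y.
Proof. by rewrite ipC ipZl ipC. Qed.

Lemma ip0l x : ip 0 x = 0.
Proof. by rewrite /ip linear0l. Qed.

Lemma ip0r x : ip x 0 = 0.
Proof. by rewrite ipC ip0l. Qed.

Lemma dot_scale c x y : hdot (c *: x) y = c * hdot x y.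
Proof. by rewrite linearZl_LR. Qed.

Lemma ip_scale c x y : ip (c *: x) y = ip x (Num.conj c *: y).
Proof. by rewrite /ip dot_scale [in RHS]dotC dot_scale rmorphM /= conjCK -dotC. Qed.

(** The imaginary part is recovered by rotating one argument, so identities
    between real inner products transfer to the complex ones. *)
Lemma dotE x y : hdot x y = ip x y +i* (- ip ('i%C *: x) y).
Proof. by rewrite /ip dot_scale; case: (hdot x y) => a b /=; congr (_ +i* _); ring. Qed.

Lemma ip_nrm x : ip x x = nrm x ^+ 2.
Proof. by rewrite /ip -hdotP normE -rmorphXn. Qed.

Lemma nrm0 : nrm 0 = 0. Proof. by rewrite /nrm normr0. Qed.

Lemma nrm_eq0 x : nrm x = 0 -> x = 0.
Proof. by move=> x0; apply/eqP; rewrite -normr_eq0 normE x0. Qed.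

Lemma nrmN x : nrm (- x) = nrm x. Proof. by rewrite /nrm normrN. Qed.

Lemma nrm_distC x y : nrm (x - y) = nrm (y - x).
Proof. by rewrite -nrmN opprB. Qed.

Lemma nrmD x y : nrm (x + y) <= nrm x + nrm y.
Proof. by rewrite -lecR rmorphD /= -!normE ler_normD. Qed.

Lemma nrmB x y : nrm (x - y) <= nrm x + nrm y.
Proof. by rewrite -(nrmN y) nrmD. Qed.

Lemma nrmZ c x : nrm (c *: x) = complex.Re `|c| * nrm x.
Proof.
rewrite /nrm normrZ normE; case: `|c| => a b /=; ring.
Qed.

Lemma nrmZr r x : nrm (r%:C *: x) = `|r| * nrm x.
Proof.
rewrite nrmZ; congr (_ * _).
by rewrite normc_def /= expr0n addr0 sqrtr_sqr.
Qed.

(** Cauchy-Schwarz: the squared norm of [|y|^2 x - <x, y> y] is nonnegative. *)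
Lemma ip_abs_le x y : `|ip x y| <= nrm x * nrm y.
Proof.
have [->|/eqP y0] := eqVneq y 0; first by rewrite ip0r normr0 nrm0 mulr0.
have b0 : 0 < nrm y.
  rewrite lt_neqAle nrm_ge0 andbT eq_sym; apply/eqP => /nrm_eq0.
  exact: y0.
rewrite -ler_sqr ?nnegrE ?normr_ge0 ?mulr_ge0 ?nrm_ge0 // real_normK ?num_real //.
pose u := (nrm y ^+ 2)%:C *: x - (ip x y)%:C *: y.
have : 0 <= ip u u by rewrite ip_nrm sqr_ge0.
rewrite /u ipBl !ipBr !ipZl !ipZr (ipC y x) !ip_nrm => h.
have {}h : 0 <= nrm y ^+ 2 * (nrm x ^+ 2 * nrm y ^+ 2 - ip x y ^+ 2) by nra.
rewrite pmulr_rge0 ?exprn_gt0// in h.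
by rewrite exprMn -subr_ge0.
Qed.

Lemma ip_le x y : ip x y <= nrm x * nrm y.
Proof. exact: le_trans (ler_norm _) (ip_abs_le x y). Qed.

Lemma nrmD_sqr x y : nrm (x + y) ^+ 2 = nrm x ^+ 2 + 2 * ip x y + nrm y ^+ 2.
Proof. by rewrite -!ip_nrm ipDl !ipDr (ipC y x); ring. Qed.

Lemma nrmB_sqr x y : nrm (x - y) ^+ 2 = nrm x ^+ 2 - 2 * ip x y + nrm y ^+ 2.
Proof. by rewrite nrmD_sqr ipNr nrmN; ring. Qed.

Lemma nrm_le_sqr x r : 0 <= r -> (nrm x <= r) = (nrm x ^+ 2 <= r ^+ 2).
Proof. by move=> r0; rewrite ler_sqr ?nnegrE ?nrm_ge0. Qed.

Lemma ip_ext x y : (forall z, ip x z = ip y z) -> x = y.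
Proof.
move=> e; apply/eqP; rewrite -subr_eq0; apply/eqP/nrm_eq0/eqP.
by rewrite -sqrf_eq0 -ip_nrm ipBl e subrr.
Qed.

(** Convergence is stated with the real-valued norm, so that limits are
    estimated in [R]. *)
Definition tendsto (u : nat -> H) x := nrm (u n - x) @[n --> \oo] --> (0 : R).

Lemma tendsto_le (u : nat -> H) x (b : nat -> R) :
  (forall n, nrm (u n - x) <= b n) -> b n @[n --> \oo] --> (0 : R) ->
  tendsto u x.
Proof.
move=> ub b0; apply: (@squeeze_cvgr _ _ _ _ (fun=> 0) b) => //; last exact: cvg_cst.
by near=> n; rewrite nrm_ge0 ub.
Unshelve. all: by end_near. Qed.

Lemma tendstoD u v x y : tendsto u x -> tendsto v y ->
  tendsto (fun n => u n + v n) (x + y).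
Proof.
move=> ux vy; apply: (@tendsto_le _ _ (fun n => nrm (u n - x) + nrm (v n - y))).
  by move=> n; rewrite opprD addrACA nrmD.
by rewrite -[0]addr0; apply: cvgD.
Qed.

Lemma tendstoZ c u x : tendsto u x -> tendsto (fun n => c *: u n) (c *: x).
Proof.
move=> ux; apply: (@tendsto_le _ _ (fun n => complex.Re `|c| * nrm (u n - x))).
  by move=> n; rewrite -scalerBr nrmZ.
by rewrite -[0](mulr0 (complex.Re `|c|)); apply: cvgMr.
Qed.

Lemma tendsto_cst x : tendsto (fun=> x) x.
Proof. by rewrite /tendsto subrr nrm0; apply: cvg_cst. Qed.

Lemma tendsto_ip u x y : tendsto u x -> ip (u n) y @[n --> \oo] --> ip x y.
Proof.
move=> ux; apply/subr_cvg0; apply: norm_cvg0.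
apply: (@squeeze_cvgr _ _ _ _ (fun=> 0) (fun n => nrm (u n - x) * nrm y)).
- by near=> n; rewrite normr_ge0 -ipBl ip_abs_le.
- exact: cvg_cst.
- by rewrite -[0](mul0r (nrm y)); apply: cvgMl.
Unshelve. all: by end_near. Qed.

Lemma nrm_dist x y : `|nrm x - nrm y| <= nrm (x - y).
Proof.
have h a b : nrm a - nrm b <= nrm (a - b).
  by rewrite lerBlDr (le_trans _ (nrmD _ _)) // subrK.
by rewrite ler_norml lerNl opprB h nrm_distC h.
Qed.

Lemma tendsto_nrm u x : tendsto u x -> nrm (u n) @[n --> \oo] --> nrm x.
Proof.
move=> ux; apply/subr_cvg0; apply: norm_cvg0.
apply: (@squeeze_cvgr _ _ _ _ (fun=> 0) (fun n => nrm (u n - x))) => //.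
- by near=> n; rewrite normr_ge0 nrm_dist.
- exact: cvg_cst.
Unshelve. all: by end_near. Qed.

Lemma tendsto_unique u x y : tendsto u x -> tendsto u y -> x = y.
Proof.
move=> ux uy; apply: ip_ext => z.
by apply: (cvg_unique _ (tendsto_ip (y := z) ux) (tendsto_ip uy)).
Qed.

Lemma tendsto_nrm_le u x r N : tendsto u x ->
  (forall n, (N <= n)%N -> nrm (u n) <= r) -> nrm x <= r.
Proof.
move=> /tendsto_nrm ux h; rewrite -(cvg_lim _ ux) //.
apply: limr_le; first by apply/cvg_ex; exists (nrm x).
by exists N.
Unshelve. all: by end_near. Qed.

(** The increments of [u] are dominated by those of a bounded monotone real
    sequence, hence [u] is Cauchy.  The rate serves in [bop_limit] and
    [gliding_hump]. *)
Lemma telescope_cvg u (b : nat -> R) (M : R) :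
  (forall n, nrm (u n.+1 - u n) <= b n.+1 - b n) -> (forall n, b n <= M) ->
  exists2 x, tendsto u x & forall n, nrm (x - u n) <= M - b n.
Proof.
move=> ub bM.
have umn n k : nrm (u (n + k)%N - u n) <= b (n + k)%N - b n.
  elim: k => [|k IH]; first by rewrite addn0 !subrr nrm0.
  rewrite addnS -(subrK (u (n + k)%N) (u _.+1)) -addrA.
  by rewrite (le_trans (nrmD _ _)) // (le_trans (lerD (ub _) IH)) // addrA subrK.
have bnd : nondecreasing_seq b.
  by apply/nondecreasing_seqP => n; rewrite -subr_ge0 (le_trans _ (ub n)) ?nrm_ge0.
have /cvg_ex[l bl] : cvgn b.
  by apply: nondecreasing_is_cvgn => //; exists M => _ [n _ <-].
have bl' n : b n <= l.
  rewrite -(cvg_lim _ bl) //; apply: nondecreasing_cvgn_le => //.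
  by apply/cvg_ex; exists l.
have uc : cauchy (u @ \oo).
  apply/cauchy_ballP => e e0.
  have eE : e = (complex.Re e)%:C by rewrite RRe_real // gtr0_real.
  have e0' : 0 < complex.Re e / 2 by rewrite divr_gt0 // -ltcR -eE.
  have /(cvgrPdist_lt _ _).1 /(_ _ e0') [N _ hN] := bl.
  have key n : (N <= n)%N -> nrm (u n - u N) < complex.Re e / 2.
    move=> Nn; rewrite -(subnKC Nn); apply: le_lt_trans (umn _ _) _.
    have := hN N (leqnn N); rewrite /= ger0_norm ?subr_ge0 //.
    by have := bl' (N + (n - N))%N; lra.
  exists (u @` [set n | (N <= n)%N], u @` [set n | (N <= n)%N]).
    by split; exists N => // n Nn /=; exists n.
  move=> [_ _] /= [[m Nm <-] [n Nn <-]].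
  rewrite -ball_normE /= normE eE ltcR -(subrK (u N) (u m)) -addrA.
  rewrite (le_lt_trans (nrmD _ _)) // (nrm_distC (u N)).
  by have := key _ Nm; have := key _ Nn; lra.
have /cvg_ex[x ux] : cvg (u @ \oo) by exact: cauchy_cvg.
have ux' : tendsto u x.
  apply/cvgr0Pnorm_lt => e e0.
  have e0' : 0 < e%:C :> R[i] by rewrite ltcR.
  move/cvgrPdist_lt: (ux) => /(_ _ e0').
  apply: filterS => n /=; rewrite normE ltcR nrm_distC => h.
  by rewrite ger0_norm ?nrm_ge0.
exists x => // n.
apply: (@tendsto_nrm_le (fun k => u k - u n) _ _ n).
  exact: tendstoD ux' (tendsto_cst _).
move=> k nk; rewrite -(subnKC nk); apply: le_trans (umn _ _) _.
by rewrite lerB.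
Unshelve. all: by end_near. Qed.

End InnerProduct.

(** * Riesz representation on closed subspaces *)

Section RieszMinimisation.
Variables (R : realType) (H : hilbert R).
Implicit Types (x y z : H) (r : R) (c : R[i]).

(** Real-linear and sequentially closed, as the minimisation below requires. *)
Definition closed_subspace (M : set H) :=
  [/\ M 0, forall x y, M x -> M y -> M (x + y), forall r x, M x -> M (r%:C *: x) &
      forall u x, (forall n, M (u n)) -> tendsto u x -> M x].

(** Minimise [|x|^2 - 2 phi x] over [M]: by the parallelogram identity a
    minimising sequence is Cauchy, and the vanishing of the first variation at
    the minimiser is the claim.  The choice [M = setT] represents functionals,
    the choice [phi = ip^~ x] projects [x] onto [M]. *)
Lemma riesz (M : set H) (phi : H -> R) (C : R) :
  closed_subspace M ->
  (forall x y, phi (x + y) = phi x + phi y) ->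
  (forall r x, phi (r%:C *: x) = r * phi x) ->
  (forall x, `|phi x| <= C * nrm x) ->
  exists2 z, M z & forall x, M x -> phi x = ip x z.
Proof.
move=> [M0 MD MZ Mc] phiD phiZ phiC.
pose J x := nrm x ^+ 2 - 2 * phi x.
have Jlb x : - C ^+ 2 <= J x.
  have h1 : phi x <= C * nrm x := le_trans (ler_norm _) (phiC x).
  have := sqr_ge0 (nrm x - C); rewrite /J; nra.
pose A := [set J x | x in M].
have infA : has_inf A by split; [exists (J 0), 0|exists (- C ^+ 2) => _ [x _ <-]].
have Jinf x : M x -> inf A <= J x.
  by move=> Mx; apply: ge_inf; [case: infA|exists x].
have ex n : exists x, M x /\ J x <= inf A + (1/4) ^+ n.
  have e0 : 0 < (1/4 : R) ^+ n by rewrite exprn_gt0 // divr_gt0.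
  have [_ [x Mx <-] /ltW h] := inf_adherent e0 infA.
  by exists x.
have [u hu] := choice ex.
have Jpar x y : M x -> M y -> nrm (x - y) ^+ 2 <= 2 * (J x + J y) - 4 * inf A.
  move=> Mx My; have := Jinf ((1/2 : R)%:C *: (x + y)) (MZ _ _ (MD _ _ Mx My)).
  rewrite /J nrmZr phiZ phiD exprMn nrmB_sqr nrmD_sqr real_normK ?num_real //.
  by nra.
(* [u n] is within [4^-n] of the infimum, so consecutive terms are within a
   multiple of [2^-n]. *)
have [|n|z uz _] := @telescope_cvg _ _ u (fun n => - (4 * (1/2) ^+ n)) 0.
- move=> n; have [Mn Jn] := hu n; have [Mn1 Jn1] := hu n.+1.
  have p0 : 0 < (1/2 : R) ^+ n by rewrite exprn_gt0 // divr_gt0.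
  have pE : (1/4 : R) ^+ n = (1/2) ^+ n * (1/2) ^+ n.
    by rewrite -exprMn; congr (_ ^+ _); lra.
  have := Jpar _ _ Mn1 Mn; rewrite nrm_le_sqr.
    move: Jn Jn1; rewrite !exprS pE; nra.
  rewrite exprS; nra.
- by rewrite oppr_le0 mulr_ge0 ?exprn_ge0 // divr_ge0.
have Mz : M z by apply: Mc uz => n; case: (hu n).
have Jz : J z <= inf A.
  have cphi : phi (u n) @[n --> \oo] --> phi z.
    apply/subr_cvg0; apply: norm_cvg0.
    apply: (@squeeze_cvgr _ _ _ _ (fun=> 0) (fun n => C * nrm (u n - z))).
    - near=> n; rewrite normr_ge0 /=; suff -> : phi (u n) - phi z = phi (u n - z) by [].
      by rewrite -(mulN1r (phi z)) -phiZ -phiD rmorphN1 scaleN1r.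
    - exact: cvg_cst.
    - by rewrite -[0](mulr0 C); apply: cvgMr.
  have cn := tendsto_nrm uz.
  have cJ : J (u n) @[n --> \oo] --> J z.
    by apply: cvgB; [exact: (cvgM cn cn)|exact: cvgMr].
  have cb : inf A + (1/4) ^+ n @[n --> \oo] --> inf A + 0.
    apply: cvgD; first exact: cvg_cst.
    by apply: cvg_expr; rewrite ger0_norm; lra.
  rewrite -(addr0 (inf A)); apply: (ler_cvg_to cJ cb).
  by near=> n; case: (hu n).
exists z => // x Mx.
have key t : 0 <= t ^+ 2 * nrm x ^+ 2 + 2 * t * (ip x z - phi x).
  have Mt := MD _ _ Mz (MZ t _ Mx).
  have := le_trans Jz (Jinf _ Mt).
  rewrite /J nrmD_sqr phiD phiZ nrmZr exprMn real_normK ?num_real // ipZr (ipC z).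
  by lra.
(* Near the minimum of the quadratic polynomial in [key]; the [+ 1] keeps the
   denominator positive. *)
pose s := (ip x z - phi x) / (nrm x ^+ 2 + 1).
have a0 : 0 <= nrm x ^+ 2 by rewrite sqr_ge0.
have sE : ip x z - phi x = s * (nrm x ^+ 2 + 1) by rewrite /s divfK //; lra.
have := key (- s); rewrite sE => h.
have s0 : s ^+ 2 = 0 by apply/eqP; rewrite eq_le sqr_ge0 andbT; nra.
move/eqP: s0; rewrite sqrf_eq0 => /eqP s0.
by move: sE; rewrite s0 mul0r => /subr0_eq.
Unshelve. all: by end_near. Qed.

End RieszMinimisation.

(** * The ring of bounded operators and its involution *)

Section BoundedOperators.
Variables (R : realType) (H : hilbert R).

Definition bounded_linear (f : H -> H) :=
  linear f /\ exists C : R, forall x, nrm (f x) <= C * nrm x.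

(** The defining property is a boolean, so operators are equal as soon as their
    underlying functions are. *)
Record bop := Bop { bfun :> H -> H; _ : `[< bounded_linear bfun >] }.

HB.instance Definition _ := [isSub for bfun].
HB.instance Definition _ := [Choice of bop by <:].

Implicit Types (S T A B : bop) (x y z : H) (c : R[i]) (r : R).

Lemma bopP T : bounded_linear T.
Proof. by case: T => f fP /=; apply/asboolP. Qed.

Definition mkbop (f : H -> H) (fP : bounded_linear f) : bop := Bop (asboolT fP).

HB.instance Definition _ T := GRing.isLinear.Build _ _ _ _ (bfun T) (bopP T).1.

Lemma bop_ext S T : (forall x, S x = T x) -> S = T.
Proof. by move=> e; apply: val_inj; apply/funext. Qed.

Lemma bop_bound T : exists2 C : R, 0 < C & forall x, nrm (T x) <= C * nrm x.
Proof.
have [_ [C h]] := bopP T; exists (`|C| + 1) => [|x].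
  by rewrite ltr_pwDr.
apply: le_trans (h x) _; apply: ler_wpM2r; first exact: nrm_ge0.
by rewrite (le_trans (ler_norm C)) // lerDl.
Qed.

Fact bop0_subproof : bounded_linear (fun=> 0 : H).
Proof.
split; first by move=> c x y; rewrite scaler0 addr0.
by exists 0 => x; rewrite nrm0 mul0r.
Qed.
Fact bopD_subproof S T : bounded_linear (fun x => S x + T x).
Proof.
split; first by move=> c x y /=; rewrite (linearP S) (linearP T) scalerDr addrACA.
have [[C _ hC] [D _ hD]] := (bop_bound S, bop_bound T).
exists (C + D) => x; rewrite mulrDl.
by rewrite (le_trans (nrmD _ _)) // lerD.
Qed.
Fact bopZ_subproof c T : bounded_linear (fun x => c *: T x).
Proof.
split; first by move=> d x y /=; rewrite (linearP T) scalerDr !scalerA mulrC.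
have [D _ hD] := bop_bound T.
exists (complex.Re `|c| * D) => x; rewrite nrmZ -mulrA ler_wpM2l //.
by rewrite -ler0c RRe_real ?normr_real.
Qed.
Fact bop1_subproof : bounded_linear (@id H).
Proof. by split; [|exists 1 => x; rewrite mul1r]. Qed.
Fact bopM_subproof S T : bounded_linear (S \o T).
Proof.
split; first by move=> d x y /=; rewrite (linearP T) (linearP S).
have [[C C0 hC] [D _ hD]] := (bop_bound S, bop_bound T).
exists (C * D) => x; rewrite (le_trans (hC _)) // -mulrA ler_wpM2l ?hD //.
exact: ltW.
Qed.

Definition bop_zero := mkbop bop0_subproof.
Definition bop_add S T := mkbop (bopD_subproof S T).
Definition bop_scale c T := mkbop (bopZ_subproof c T).
Definition bop_opp T := bop_scale (-1) T.
Definition bop_one := mkbop bop1_subproof.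
Definition bop_mul S T := mkbop (bopM_subproof S T).

Fact bop_addA : associative bop_add.
Proof. by move=> A B C; apply: bop_ext => x; apply: addrA. Qed.
Fact bop_addC : commutative bop_add.
Proof. by move=> A B; apply: bop_ext => x; apply: addrC. Qed.
Fact bop_add0 : left_id bop_zero bop_add.
Proof. by move=> A; apply: bop_ext => x; apply: add0r. Qed.
Fact bop_addN : left_inverse bop_zero bop_opp bop_add.
Proof. by move=> A; apply: bop_ext => x /=; rewrite scaleN1r addNr. Qed.
HB.instance Definition _ :=
  GRing.isZmodule.Build bop bop_addA bop_addC bop_add0 bop_addN.

Fact bop_mulA : associative bop_mul.
Proof. by move=> A B C; apply: bop_ext. Qed.
Fact bop_mul1 : left_id bop_one bop_mul.
Proof. by move=> A; apply: bop_ext. Qed.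
Fact bop_mulr1 : right_id bop_one bop_mul.
Proof. by move=> A; apply: bop_ext. Qed.
Fact bop_mulDl : left_distributive bop_mul +%R.
Proof. by move=> A B C; apply: bop_ext. Qed.
Fact bop_mulDr : right_distributive bop_mul +%R.
Proof. by move=> A B C; apply: bop_ext => x; apply: linearD. Qed.
HB.instance Definition _ := GRing.Zmodule_isPzRing.Build bop
  bop_mulA bop_mul1 bop_mulr1 bop_mulDl bop_mulDr.

Fact bop_scaleA c d T : bop_scale c (bop_scale d T) = bop_scale (c * d) T.
Proof. by apply: bop_ext => x; apply: scalerA. Qed.
Fact bop_scale1 : left_id 1 bop_scale.
Proof. by move=> T; apply: bop_ext => x; apply: scale1r. Qed.
Fact bop_scaleDr : right_distributive bop_scale +%R.
Proof. by move=> c S T; apply: bop_ext => x; apply: scalerDr. Qed.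
Fact bop_scaleDl T : {morph bop_scale^~ T : c d / c + d}.
Proof. by move=> c d; apply: bop_ext => x; apply: scalerDl. Qed.
HB.instance Definition _ := GRing.Zmodule_isLmodule.Build R[i] bop
  bop_scaleA bop_scale1 bop_scaleDr bop_scaleDl.

(** The morphism lemmas of the structure, with both sides displaying [T] itself
    so that later rewriting finds its occurrences. *)
Lemma opD T x y : T (x + y) = T x + T y. Proof. exact: linearD. Qed.
Lemma opB T x y : T (x - y) = T x - T y. Proof. exact: linearB. Qed.
Lemma opN T x : T (- x) = - T x. Proof. exact: linearN. Qed.
Lemma opZ T c x : T (c *: x) = c *: T x. Proof. exact: linearZ. Qed.
Lemma op0 T : T 0 = 0. Proof. exact: linear0. Qed.

Lemma bop0E x : (0 : bop) x = 0. Proof. by []. Qed.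
Lemma bop1E x : (1 : bop) x = x. Proof. by []. Qed.
Lemma bopDE S T x : (S + T) x = S x + T x. Proof. by []. Qed.
Lemma bopZE c T x : (c *: T) x = c *: T x. Proof. by []. Qed.
Lemma bopME S T x : (S * T) x = S (T x). Proof. by []. Qed.
Lemma bopNE T x : (- T) x = - T x.
Proof. exact: scaleN1r. Qed.
Lemma bopBE S T x : (S - T) x = S x - T x. Proof. by rewrite bopDE bopNE. Qed.
Definition bopE := (bop0E, bop1E, bopBE, bopDE, bopNE, bopZE, bopME).

(** The ring of operators on the zero space is trivial, so the operators do not
    form an algebra in the sense of nontrivial rings; the two compatibilities
    of scaling and product are stated separately. *)
Lemma bop_scalel c S T : (c *: S) * T = c *: (S * T).
Proof. exact: bop_ext. Qed.

Lemma bop_scaler c S T : S * (c *: T) = c *: (S * T).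
Proof. by apply: bop_ext => x; rewrite !bopE linearZ. Qed.

Lemma commZ c S T : GRing.comm S T -> GRing.comm S (c *: T).
Proof. by move=> h; rewrite /GRing.comm bop_scalel bop_scaler h. Qed.

Lemma nrm_le_ip x r : 0 <= r -> ip x x <= r * nrm x -> nrm x <= r.
Proof.
move=> r0; rewrite ip_nrm expr2; have [->//|x0] := eqVneq (nrm x) 0.
by rewrite ler_pM2r // lt_neqAle eq_sym x0 nrm_ge0.
Qed.

Lemma tendsto_bop T u x : tendsto u x -> tendsto (fun n => T (u n)) (T x).
Proof.
have [C C0 hC] := bop_bound T => ux.
apply: (@tendsto_le _ _ _ _ (fun n => C * nrm (u n - x))).
  by move=> n; rewrite -linearB hC.
by rewrite -[0](mulr0 C); apply: cvgMr.
Qed.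

(** For fixed [y], [ip (T x) y] is a bounded functional of [x]; Riesz
    representation gives the value of the adjoint at [y]. *)
Lemma adj_exists T : exists B, forall x y, ip (T x) y = ip x (B y).
Proof.
have [C C0 hC] := bop_bound T.
have Hsub : closed_subspace [set: H] by split.
have ex y : exists z, forall x, ip (T x) y = ip x z.
  have [|r x|x|z _ hz] := @riesz _ _ setT (fun x => ip (T x) y) (C * nrm y) Hsub.
  - by move=> a b; rewrite linearD ipDl.
  - by rewrite linearZ ipZl.
  - rewrite (le_trans (ip_abs_le _ _)) // mulrAC ler_wpM2r ?nrm_ge0 //.
  - by exists z => x; apply: hz.
have [B hB] := choice ex.
suff Bbl : bounded_linear B by exists (mkbop Bbl) => x y; apply: hB.
split.
  move=> c y z; apply: ip_ext => x; rewrite ipC -hB ipC.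
  rewrite !ipDl !ip_scale -linearZ (ipC y) (ipC z) !hB.
  by rewrite (ipC (B y)) (ipC (B z)).
exists C => y.
apply: nrm_le_ip; first by rewrite mulr_ge0 ?nrm_ge0 ?ltW.
by rewrite -hB (le_trans (ip_le _ _)) // mulrAC ler_wpM2r ?nrm_ge0.
Qed.

Definition adj T := sval (cid (adj_exists T)).

Lemma adjP T x y : ip (T x) y = ip x (adj T y).
Proof. by rewrite /adj; case: cid. Qed.

Lemma adjP' T x y : ip x (T y) = ip (adj T x) y.
Proof. by rewrite ipC adjP ipC. Qed.

Lemma adj_eq T B : (forall x y, ip (T x) y = ip x (B y)) -> adj T = B.
Proof.
move=> h; apply: bop_ext => y; apply: ip_ext => x.
by rewrite ipC -adjP h ipC.
Qed.

Lemma adjK T : adj (adj T) = T.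
Proof. by apply: adj_eq => x y; rewrite -adjP'. Qed.

Lemma adjM S T : adj (S * T) = adj T * adj S.
Proof. by apply: adj_eq => x y; rewrite !bopE !adjP. Qed.

Lemma adjD S T : adj (S + T) = adj S + adj T.
Proof. by apply: adj_eq => x y; rewrite !bopE ipDl ipDr !adjP. Qed.

Lemma adjZ c T : adj (c *: T) = Num.conj c *: adj T.
Proof. by apply: adj_eq => x y; rewrite !bopE ip_scale adjP linearZ. Qed.

Lemma adjN T : adj (- T) = - adj T.
Proof. by apply: adj_eq => x y; rewrite !bopE ipNl ipNr !adjP. Qed.

Lemma adjB S T : adj (S - T) = adj S - adj T.
Proof. by rewrite adjD adjN. Qed.

Lemma adj1 : adj 1 = 1.
Proof. exact: adj_eq. Qed.

Lemma adjZr r T : adj (r%:C *: T) = r%:C *: adj T.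
Proof. by rewrite adjZ; congr (_ *: _); apply/eqP; rewrite eq_complex /= oppr0 !eqxx. Qed.

Lemma adj0 : adj 0 = 0.
Proof. by apply: adj_eq => x y; rewrite !bopE ip0l ip0r. Qed.

Lemma comm_adj S T : GRing.comm S T -> GRing.comm (adj S) (adj T).
Proof. by move=> h; rewrite /GRing.comm -!adjM h. Qed.

Lemma bop_dotE T x y : hdot (T x) y = hdot x (adj T y).
Proof. by rewrite !dotE adjP -linearZ adjP. Qed.

(** The bound on the increments yields pointwise convergence and, through the
    rate in [telescope_cvg], boundedness of the limit. *)
Lemma bop_limit (T : nat -> bop) (b : nat -> R) (M : R) :
  (forall n x, nrm (T n.+1 x - T n x) <= (b n.+1 - b n) * nrm x) ->
  (forall n, b n <= M) ->
  exists L : bop, forall x, tendsto (fun n => T n x) (L x).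
Proof.
move=> hT hb.
have ex x : exists y, tendsto (fun n => T n x) y.
  have [||y hy _] := @telescope_cvg _ _ (fun n => T n x) (fun n => b n * nrm x) (M * nrm x).
  - by move=> n; rewrite -mulrBl.
  - by move=> n; rewrite ler_wpM2r ?nrm_ge0.
  - by exists y.
have [L hL] := choice ex.
suff Lbl : bounded_linear L by exists (mkbop Lbl).
have [C C0 hC] := bop_bound (T 0%N).
split.
  move=> c x y; apply: tendsto_unique (hL _) _.
  rewrite [F in tendsto F](_ : _ = fun n => c *: T n x + T n y).
    by apply: tendstoD => //; apply: tendstoZ.
  by apply/funext => n; rewrite linearP.
exists (C + (M - b 0%N)) => x.
have [||y hy hy'] := @telescope_cvg _ _ (fun n => T n x) (fun n => b n * nrm x) (M * nrm x).
- by move=> n; rewrite -mulrBl.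
- by move=> n; rewrite ler_wpM2r ?nrm_ge0.
- rewrite (tendsto_unique (hL x) hy) -(subrK (T 0%N x) y) addrC.
  rewrite (le_trans (nrmD _ _)) // mulrDl lerD //.
  by rewrite mulrBl hy'.
Qed.

End BoundedOperators.

(** * Square roots and spectral projections *)

Section SelfAdjoint.
Variables (R : realType) (H : hilbert R).
Implicit Types (S T A B K L Q X Y Z : bop H) (x y z : H) (c : R[i]) (r : R).

Definition selfadj A := adj A = A.
Definition contraction A := forall x, nrm (A x) <= nrm x.
Definition positive A := forall x, 0 <= ip (A x) x.

Lemma selfadjP A : selfadj A -> forall x y, ip (A x) y = ip x (A y).
Proof. by move=> h x y; rewrite adjP h. Qed.

Lemma selfadjB A B : selfadj A -> selfadj B -> selfadj (A - B).
Proof. by rewrite /selfadj adjB => -> ->. Qed.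

Lemma selfadjD A B : selfadj A -> selfadj B -> selfadj (A + B).
Proof. by rewrite /selfadj adjD => -> ->. Qed.

Lemma selfadjZ r A : selfadj A -> selfadj (r%:C *: A).
Proof. by rewrite /selfadj adjZr => ->. Qed.

Lemma selfadj1 : selfadj 1. Proof. exact: adj1. Qed.

Lemma selfadjM A B : selfadj A -> selfadj B -> GRing.comm A B -> selfadj (A * B).
Proof. by move=> hA hB AB; rewrite /selfadj adjM hA hB AB. Qed.

Lemma selfadj_adjM T : selfadj (adj T * T).
Proof. by rewrite /selfadj adjM adjK. Qed.

Lemma comm_selfadj Z A : selfadj A -> GRing.comm Z A -> GRing.comm (adj Z) A.
Proof. by move=> hA h; rewrite -hA; apply: comm_adj. Qed.

Lemma contractionM A B : contraction A -> contraction B -> contraction (A * B).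
Proof. by move=> hA hB x; rewrite bopE (le_trans (hA _)). Qed.

(** [|x - Y (Y x)|^2 = |x|^2 - 2 |Y x|^2 + |Y (Y x)|^2], and the last term is
    at most [|Y x|^2]. *)
Lemma contraction_subSq Y : selfadj Y -> contraction Y -> contraction (1 - Y * Y).
Proof.
move=> sY cY x; rewrite nrm_le_sqr ?nrm_ge0 // !bopE nrmB_sqr.
rewrite -(selfadjP sY) ip_nrm.
have := cY (Y x); rewrite nrm_le_sqr ?nrm_ge0 //.
by have := sqr_ge0 (nrm (Y x)); lra.
Qed.

Lemma positive_sub A : contraction (1 - A) -> positive A.
Proof.
move=> h x; have h1 := ip_le ((1 - A) x) x.
have h2 : nrm ((1 - A) x) * nrm x <= nrm x * nrm x by rewrite ler_wpM2r ?nrm_ge0.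
by have := le_trans h1 h2; rewrite !bopE ipBl ip_nrm expr2; lra.
Qed.

Lemma limit_comm (T : nat -> bop H) L Z :
  (forall x, tendsto (fun n => T n x) (L x)) ->
  (forall n, GRing.comm Z (T n)) -> GRing.comm Z L.
Proof.
move=> hL hZ; apply: bop_ext => x; rewrite !bopE.
apply: tendsto_unique (tendsto_bop Z (hL x)) _.
rewrite [F in tendsto F](_ : _ = fun n => T n (Z x)) //.
by apply/funext => n; rewrite -!bopME hZ.
Qed.

Lemma limit_selfadj (T : nat -> bop H) L :
  (forall x, tendsto (fun n => T n x) (L x)) ->
  (forall n, selfadj (T n)) -> selfadj L.
Proof.
move=> hL hT; apply: adj_eq => x y.
have h1 := tendsto_ip (y := y) (hL x).
have h2 := tendsto_ip (y := x) (hL y).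
rewrite (ipC x) -(cvg_lim _ h1) // -(cvg_lim _ h2) //.
suff -> : (fun n => ip (T n x) y) = (fun n => ip (T n y) x) by [].
by apply/funext => n; rewrite (selfadjP (hT n)) ipC.
Qed.

Lemma limit_contraction (T : nat -> bop H) L :
  (forall x, tendsto (fun n => T n x) (L x)) ->
  (forall n, contraction (T n)) -> contraction L.
Proof.
by move=> hL hT x; apply: (tendsto_nrm_le (N := 0%N) (hL x)) => n _; apply: hT.
Qed.

Lemma limit_sq (T : nat -> bop H) L :
  (forall x, tendsto (fun n => T n x) (L x)) ->
  (forall n, contraction (T n)) ->
  forall x, tendsto (fun n => (T n * T n) x) ((L * L) x).
Proof.
move=> hL hT x.
apply: (@tendsto_le _ _ _ _ (fun n => nrm (T n x - L x) + nrm (T n (L x) - L (L x)))).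
  move=> n; rewrite !bopE -(subrK (T n (L x)) (T n _)) -addrA.
  by rewrite (le_trans (nrmD _ _)) // lerD // -opB hT.
by rewrite -[0]addr0; apply: cvgD; apply: hL.
Qed.

(** Put [K = 1 - L] and [X = 1 - A]: the equation [K * K = A] reads [L = (X + L
    * L) / 2], which is solved by iteration from 0.  The increments of the
    iterates are dominated by those of the scalar iteration [b |-> (1 + b^2) /
    2], bounded by 1, so norm estimates give convergence.  The bound on [1 - K]
    makes [K] positive and lets the lemma be applied to [K]. *)
Lemma sqrt_exists A : selfadj A -> contraction (1 - A) ->
  exists K, [/\ selfadj K, K * K = A, contraction (1 - K) &
                forall Z, GRing.comm Z A -> GRing.comm Z K].
Proof.
move=> sA cX; set X := 1 - A in cX.
pose h : R[i] := (1/2 : R)%:C.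
pose B := fix B n := if n is m.+1 then h *: (X + B m * B m) else 0.
pose b := fix b n : R := if n is m.+1 then (1 + b m * b m) / 2 else 0.
have b01 n : 0 <= b n <= 1.
  by elim: n => [|n /andP[h0 h1]] /=; [lra|apply/andP; split; nra].
have BE n : B n.+1 = h *: (X + B n * B n) by [].
have bE n : b n.+1 = (1 + b n * b n) / 2 by [].
have Bb n x : nrm (B n x) <= b n * nrm x.
  elim: n x => [|n IH] x; first by rewrite bopE nrm0 mul0r.
  have /andP[b0 _] := b01 n.
  rewrite BE bE bopZE nrmZr ger0_norm; last by lra.
  have := nrmD (X x) ((B n * B n) x).
  have := cX x; have := IH (B n x).
  have : b n * nrm (B n x) <= b n * (b n * nrm x) by rewrite ler_wpM2l.
  rewrite bopDE !bopME; set q := nrm (_ + _); lra.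
have diffsq (Y P Q : bop H) x :
    (Y + P * P) x - (Y + Q * Q) x = P (P x - Q x) + (P - Q) (Q x).
  by rewrite opB !bopDE bopNE !bopME opprD addrACA subrr add0r addrA subrK.
have dB n x : nrm (B n.+1 x - B n x) <= (b n.+1 - b n) * nrm x.
  elim: n x => [|n IH] x.
    rewrite BE bopZE bopDE bopME subr0 bop0E addr0 nrmZr.
    by have := cX x; rewrite ger0_norm /=; lra.
  have /andP[b0 _] := b01 n; have /andP[b1 _] := b01 n.+1.
  have -> : B n.+2 x - B n.+1 x =
      h *: (B n.+1 (B n.+1 x - B n x) + (B n.+1 - B n) (B n x)).
    by rewrite (BE n.+1) [in X in _ - X](BE n) !bopZE -scalerBr diffsq.
  rewrite nrmZr ger0_norm; last by lra.
  have := nrmD (B n.+1 (B n.+1 x - B n x)) ((B n.+1 - B n) (B n x)).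
  have h1 := Bb n.+1 (B n.+1 x - B n x).
  have h2 : b n.+1 * nrm (B n.+1 x - B n x) <= b n.+1 * ((b n.+1 - b n) * nrm x).
    by rewrite ler_wpM2l.
  have h3 := IH (B n x).
  have h4 : (b n.+1 - b n) * nrm (B n x) <= (b n.+1 - b n) * (b n * nrm x).
    by rewrite ler_wpM2l // bE; have := sqr_ge0 (1 - b n); nra.
  rewrite bopBE; set q := nrm (_ + _); rewrite (bE n.+1) (bE n) in h1 h2 h3 h4 *.
  set n1 := nrm _ in h1 h2 *; set n2 := nrm _ in h1 *; set n3 := nrm _ in h3 *.
  nra.
have cB n : contraction (B n).
  move=> x; apply: le_trans (Bb n x) _.
  by have /andP[_ b1] := b01 n; rewrite ler_piMl ?nrm_ge0.
have [|L hL] := bop_limit dB (M := 1); first by move=> n; case/andP: (b01 n).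
have sL : selfadj L.
  apply: limit_selfadj hL _; elim=> [|n IH]; first exact: adj0.
  apply: selfadjZ; apply: selfadjD; first by apply: selfadjB => //; apply: selfadj1.
  exact: selfadjM.
have LE : L = h *: (X + L * L).
  apply: bop_ext => x; have hL' : tendsto (fun n => B n.+1 x) (L x).
    by rewrite /tendsto (cvg_shiftS (fun n => nrm (B n x - L x))); apply: hL.
  apply: tendsto_unique hL' _; rewrite bopZE bopDE.
  apply: tendstoZ; apply: (tendstoD (tendsto_cst _)); exact: limit_sq.
have L2 : L * L = L + L - X.
  have e : X + L * L = L + L.
    rewrite {3 4}LE -scalerDl /h -rmorphD /= (_ : 1/2 + 1/2 = 1) ?scale1r //; lra.
  by rewrite -e addrC addKr.
exists (1 - L); split.
- by apply: selfadjB => //; apply: selfadj1.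
- rewrite mulrBl mul1r mulrBr mulr1 L2 opprB (addrAC (L + L)) addrK addrA subrK.
  exact: subKr.
- by rewrite opprB addrC subrK; apply: limit_contraction hL _.
move=> Z ZA; apply: commrB; first exact: commr1.
apply: limit_comm hL _; elim=> [|n IH]; first exact: commr0.
apply: commZ; apply: commrD; first by apply: commrB => //; apply: commr1.
exact: commrM.
Qed.

Definition projection Q := selfadj Q /\ Q * Q = Q.

(** An operator commuting with [Y] preserves the kernel of [Y]; so does its
    adjoint, since [Y] is selfadjoint; hence it commutes with the projection. *)
Lemma kernel_projection Y : selfadj Y ->
  exists Q, [/\ projection Q, Y * Q = 0, forall x, Y x = 0 -> Q x = x &
                forall Z, GRing.comm Z Y -> GRing.comm Z Q].
Proof.
move=> sY.
have Msub : closed_subspace [set x | Y x = 0].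
  split; first exact: op0.
  - by move=> x y /= hx hy; rewrite opD hx hy addr0.
  - by move=> r x /= hx; rewrite opZ hx scaler0.
  - move=> u x /= hu ux; apply: (tendsto_unique (tendsto_bop Y ux)).
    rewrite [F in tendsto F](_ : _ = fun=> 0); last by apply/funext.
    exact: tendsto_cst.
have ex x : exists z, Y z = 0 /\ forall w, Y w = 0 -> ip w x = ip w z.
  have [|r w|w|z hz hz'] := @riesz _ _ _ (fun w => ip w x) (nrm x) Msub.
  - by move=> a b; rewrite ipDl.
  - by rewrite ipZl.
  - by rewrite mulrC ip_abs_le.
  - by exists z; split => // w /hz'.
have [q hq] := choice ex.
have qY x : Y (q x) = 0 by case: (hq x).
have qip w x : Y w = 0 -> ip w x = ip w (q x) by case: (hq x) => _; apply.
have quniq x z : Y z = 0 -> (forall w, Y w = 0 -> ip w x = ip w z) -> q x = z.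
  move=> Yz h; apply/eqP; rewrite -subr_eq0; apply/eqP/nrm_eq0/eqP.
  have Yqz : Y (q x - z) = 0 by rewrite opB qY Yz subrr.
  by rewrite -sqrf_eq0 -ip_nrm ipBr -qip // h // subrr.
have qbl : bounded_linear q.
  split.
    move=> c x y; apply: quniq; first by rewrite opD opZ !qY scaler0 addr0.
    move=> w Yw; rewrite !ipDr; congr (_ + _); last exact: qip.
    by rewrite !(ipC w) !ip_scale !(ipC _ (_ *: w)) -qip // opZ Yw scaler0.
  exists 1 => x; rewrite mul1r; apply: nrm_le_ip; first exact: nrm_ge0.
  by rewrite -qip // mulrC ip_le.
pose Q := mkbop qbl.
have Qfix x : Y x = 0 -> Q x = x by move=> Yx; apply: quniq.
have sQ : selfadj Q.
  by apply: adj_eq => x y /=; rewrite [in LHS]qip // ipC -qip // ipC.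
have ZQ Z : GRing.comm Z Y -> Z * Q = Q * Z * Q.
  move=> ZY; apply: bop_ext => x; rewrite !bopE (Qfix (Z (Q x))) //.
  by rewrite -bopME -ZY bopME [Y _]qY op0.
exists Q; split => //.
- by split=> //; apply: bop_ext => x; rewrite bopME Qfix //; apply: qY.
- by apply: bop_ext => x; apply: qY.
move=> Z ZY; rewrite /GRing.comm ZQ //.
have := ZQ _ (comm_selfadj sY ZY); move/(congr1 (@adj _ _)).
by rewrite !adjM !adjK sQ mulrA.
Qed.

(** Scale [A] to a contraction, let [K] be the square root of [A * A], and [Q]
    the projection onto the kernel of [K - A].  On the range of [Q], [A] equals
    [K].  As [(K - A) * (K + A) = 0], the range of [K + A] lies in that kernel,
    so [A] equals [- K] on the kernel of [Q].  There [K] is injective, because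
    the kernel of [K] is contained in that of [K - A]; this makes the
    inequality strict. *)
Lemma spectral_projection A : selfadj A ->
  exists Q, [/\ projection Q, forall Z, GRing.comm Z A -> GRing.comm Z Q,
     forall x, Q x = x -> 0 <= ip (A x) x &
     forall x, Q x = 0 -> x != 0 -> ip (A x) x < 0].
Proof.
move=> sA.
have [C C0 hC] := bop_bound A.
pose A' := C^-1%:C *: A.
have sA' : selfadj A' by apply: selfadjZ.
have cA' : contraction A'.
  move=> x; rewrite bopE nrmZr ger0_norm ?invr_ge0 ?(ltW C0) //.
  by rewrite mulrC ler_pdivrMr // mulrC.
have ipA' x : ip (A' x) x = C^-1 * ip (A x) x by rewrite bopE ipZl.
have commA' Z : GRing.comm Z A -> GRing.comm Z A' by apply: commZ.
have [K [sK KK cK commK]] :=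
  sqrt_exists (selfadjM sA' sA' erefl) (contraction_subSq sA' cA').
have [L [sL LL _ _]] := sqrt_exists sK cK.
have commK' Z : GRing.comm Z A -> GRing.comm Z K.
  by move=> /commA' h; apply: commK; apply: commrM.
have KA : GRing.comm A' K by apply: commK; apply: commrM.
have [Q [pQ NQ Qfix commQ]] := kernel_projection (selfadjB sK sA').
have commQ' Z : GRing.comm Z A -> GRing.comm Z Q.
  by move=> h; apply/commQ/commrB; [apply: commK'|apply: commA'].
exists Q; split => // x Qx.
  rewrite -(@pmulr_rge0 _ C^-1) ?invr_gt0 // -ipA'.
  have := congr1 (fun T : bop H => T x) NQ; rewrite !bopE Qx => /subr0_eq <-.
  exact: positive_sub.
move=> x0; rewrite -(@pmulr_rlt0 _ C^-1) ?invr_gt0 // -ipA'.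
have NKA : (K - A') * (K + A') = 0.
  by rewrite mulrDr !mulrBl KK KA addrA subrK subrr.
have AKx : A' x = - K x.
  apply/eqP; rewrite -addr_eq0 addrC; apply/eqP.
  have QKA : Q ((K + A') x) = (K + A') x.
    by apply: Qfix; rewrite -bopME NKA.
  have cQ : GRing.comm (K + A') Q.
    apply/commr_sym/commrD; apply/commr_sym/commQ'/commr_sym.
      by apply: commK'.
    by apply: commA'.
  by rewrite -bopDE -QKA -bopME -cQ bopME Qx op0.
rewrite AKx ipNl oppr_lt0 -LL bopME selfadjP // ip_nrm exprn_gt0 //.
rewrite lt_neqAle nrm_ge0 andbT eq_sym; apply: contra_neq x0 => /nrm_eq0 Lx.
have Kx : K x = 0 by rewrite -LL bopME Lx op0.
by rewrite -(Qfix x) // bopBE AKx Kx oppr0 subrr.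
Qed.

End SelfAdjoint.

(** * Localising a selfadjoint operator at a point of its spectrum *)

Section Localisation.
Variables (R : realType) (H : hilbert R).
Implicit Types (S T A B F E Z : bop H) (Q : nat -> bop H) (x y z : H) (r l w : R).

Lemma projectionM E F : projection E -> projection F -> GRing.comm E F ->
  projection (E * F).
Proof.
move=> [sE EE] [sF FF] EF; split; first exact: selfadjM.
by rewrite mulrA -(mulrA E) -EF mulrA EE -mulrA FF.
Qed.

Lemma projectionC E : projection E -> projection (1 - E).
Proof.
move=> [sE EE]; split; first by apply: selfadjB => //; apply: selfadj1.
by rewrite mulrBl mul1r mulrBr mulr1 EE subrr subr0.
Qed.

Lemma projC_fix E x : (1 - E) x = x -> E x = 0.
Proof. by rewrite bopBE bop1E => h; rewrite -[LHS](subKr x) h subrr. Qed.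

Lemma op_neq0 T : T != 0 -> exists x, T x != 0.
Proof.
move=> T0; apply: contrapT => h; move/eqP: T0; apply.
by apply: bop_ext => x; apply/eqP/negPn/negP => Tx; apply: h; exists x.
Qed.

(** Evaluate the form of [A - l], which is nonnegative on the range of [F], at
    [x - w^-1 y] where [y = A x - l x]. *)
Lemma numeric_range_bound A F l w : selfadj A -> GRing.comm A F -> 0 < w ->
  (forall x, F x = x -> l * nrm x ^+ 2 <= ip (A x) x <= (l + w) * nrm x ^+ 2) ->
  forall x, F x = x -> nrm (A x - l%:C *: x) <= w * nrm x.
Proof.
move=> sA AF w0 h x Fx; set y := A x - _.
have Fy : F y = y by rewrite opB opZ -bopME -AF bopME Fx.
have yy : nrm y ^+ 2 = ip (A x) y - l * ip x y.
  by rewrite -ip_nrm {1}/y ipBl ipZl.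
have xy : ip x y = ip (A x) x - l * nrm x ^+ 2.
  by rewrite /y ipBr ipZr -(selfadjP sA) ip_nrm.
clearbody y.
pose z := x - w^-1%:C *: y.
have Fz : F z = z by rewrite opB opZ Fx Fy.
have /andP[hz _] := h _ Fz; have /andP[_ hy] := h _ Fy; have /andP[_ hx] := h _ Fx.
have Az : ip (A z) z - l * nrm z ^+ 2
    = ip x y - 2 * w^-1 * nrm y ^+ 2 + w^-1 ^+ 2 * (ip (A y) y - l * nrm y ^+ 2).
  rewrite /z opB opZ -[nrm (x - _) ^+ 2]ip_nrm !ipBl !ipBr !ipZl !ipZr.
  rewrite (selfadjP sA y) (ipC y (A x)) (ipC y x) !ip_nrm.
  have -> : ip (A x) y = nrm y ^+ 2 + l * ip x y by rewrite yy; ring.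
  by rewrite xy; ring.
have wV : w^-1 * w = 1 by rewrite mulVf // gt_eqF.
have w0' : 0 < w^-1 by rewrite invr_gt0.
have h1 : w^-1 ^+ 2 * (ip (A y) y - l * nrm y ^+ 2) <= w^-1 * nrm y ^+ 2.
  have -> : w^-1 * nrm y ^+ 2 = w^-1 ^+ 2 * (w * nrm y ^+ 2).
    by rewrite expr2 -mulrA (mulrA w^-1 w) wV mul1r.
  by rewrite ler_wpM2l ?sqr_ge0 //; lra.
have h2 : w^-1 * nrm y ^+ 2 <= w * nrm x ^+ 2 by lra.
have h3 : nrm y ^+ 2 <= w * (w * nrm x ^+ 2).
  by rewrite -(ler_pM2l w0') (mulrA w^-1 w) wV mul1r.
by rewrite nrm_le_sqr ?mulr_ge0 ?nrm_ge0 ?(ltW w0) // exprMn expr2 -mulrA.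
Qed.

(** A decreasing sequence of nonzero projections plays the part of a point of
    the spectrum.  Keeping a whole sequence allows one operator to be localised
    after another. *)
Definition chain Q := forall k, [/\ projection (Q k), Q k != 0 & Q k.+1 * Q k = Q k.+1].

Lemma chain_le Q k m : chain Q -> (k <= m)%N -> Q m * Q k = Q m.
Proof.
move=> cQ km; rewrite -(subnKC km); elim: (m - k)%N => [|j IH].
  by rewrite addn0; case: (cQ k) => -[].
by rewrite addnS; case: (cQ (k + j)%N) => _ _ <-; rewrite -mulrA IH.
Qed.

(** Bisection.  The spectral projection of [A] at the midpoint of the current
    interval splits the current projection in two.  One of the halves has
    nonzero product with every [Q k]: otherwise some [Q k] would annihilate the
    current projection. *)
Lemma localise Q A : chain Q -> selfadj A -> (forall k, GRing.comm A (Q k)) ->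
  exists (a D : R) Q', [/\ chain Q', forall k, Q k * Q' k = Q' k,
    forall Z, GRing.comm Z A -> (forall k, GRing.comm Z (Q k)) ->
      forall k, GRing.comm Z (Q' k) &
    forall k x, Q' k x = x -> nrm (A x - a%:C *: x) <= D * (1/2) ^+ k * nrm x].
Proof.
move=> cQ sA AQ.
have [C C0 hC] := bop_bound A.
pose w n : R := 2 * C * (1/2) ^+ n.
have w0 n : 0 < w n by rewrite mulr_gt0 ?exprn_gt0 //; lra.
pose good n (s : bop H * R) :=
  [/\ projection s.1, forall Z, GRing.comm Z A -> GRing.comm Z s.1,
      forall x, s.1 x = x ->
        s.2 * nrm x ^+ 2 <= ip (A x) x <= (s.2 + w n) * nrm x ^+ 2 &
      forall k, Q k * s.1 != 0].
have step n s : good n s -> exists s', good n.+1 s' /\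
    [/\ s'.1 * s.1 = s'.1, s.2 <= s'.2 & s'.2 + w n.+1 <= s.2 + w n].
  case: s => F l [/= pF commF hF QF].
  have wS : w n = w n.+1 + w n.+1 by rewrite /w exprS; lra.
  pose m := l + w n.+1.
  have sAm : selfadj (A - m%:C *: (1 : bop H)).
    by apply: selfadjB => //; apply: selfadjZ; apply: selfadj1.
  have [E [pE commE hE1 hE2]] := spectral_projection sAm.
  have ipm x : ip ((A - m%:C *: (1 : bop H)) x) x = ip (A x) x - m * nrm x ^+ 2.
    by rewrite !bopE ipBl ipZl ip_nrm.
  have commE' Z : GRing.comm Z A -> GRing.comm Z E.
    by move=> ZA; apply/commE/commrB => //; apply/commZ/commr1.
  have FE : GRing.comm F E by apply/commE'/commr_sym/commF.
  have FE' : GRing.comm F (1 - E) by apply: commrB => //; apply: commr1.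
  have fixM (G : bop H) x : projection G -> GRing.comm F G -> (F * G) x = x ->
      F x = x /\ G x = x.
    move=> [_ GG] FG e; split; rewrite -{1}e -{2}e.
      by rewrite -!bopME mulrA; case: pF => _ ->.
    by rewrite FG -!bopME mulrA GG.
  have [h|/existsNP[k0 /negP/negPn/eqP Qk0]] := pselect (forall k, Q k * (F * E) != 0).
    exists (F * E, m); split; last first.
      have := w0 n.+1; split=> /=; [|rewrite /m; lra|rewrite /m wS; lra].
      by rewrite -mulrA -FE mulrA; case: pF => _ ->.
    split=> //=; first exact: projectionM.
      by move=> Z ZA; apply: commrM; [apply: commF|apply: commE'].
    move=> x /(fixM _ _ pE FE)[Fx Ex].
    have := hE1 _ Ex; rewrite ipm; have /andP[_] := hF _ Fx.
    by rewrite /m wS; move=> *; apply/andP; split; lra.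
  exists (F * (1 - E), l); split; last first.
    split=> /=; [by rewrite -mulrA -FE' mulrA; case: pF => _ -> | by [] | ].
    by have := w0 n.+1; lra.
  split=> //=; first by apply: projectionM => //; apply: projectionC.
  - move=> Z ZA; apply: commrM; first exact: commF.
    by apply: commrB; [apply: commr1|apply: commE'].
  - move=> x /(fixM _ _ (projectionC pE) FE')[Fx Ex].
    have {}Ex : E x = 0 by exact: projC_fix.
    have := hE2 _ Ex; rewrite ipm; have /andP[h1 _] := hF _ Fx.
    have [->|x0 /(_ isT) h2] := eqVneq x 0; first by rewrite nrm0 op0 ip0l expr0n /= !mulr0 lexx.
    by apply/andP; split => //; move: h2; rewrite /m; lra.
  - move=> k1; apply/eqP => Qk1; have := QF (maxn k0 k1); apply/negP/negPn/eqP.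
    have -> : F = F * E + F * (1 - E) by rewrite -mulrDr addrC subrK mulr1.
    rewrite mulrDr -(chain_le cQ (leq_maxl k0 k1)) -mulrA Qk0 mulr0 add0r.
    by rewrite (chain_le cQ (leq_maxl k0 k1)) -(chain_le cQ (leq_maxr k0 k1)) -mulrA Qk1 mulr0.
have good0 : good 0%N (1, - C).
  split=> /=; [by split; [exact: selfadj1|rewrite mulr1]|by move=> Z _; apply: commr1| |].
    move=> x _; have := ip_abs_le (A x) x; rewrite ler_norml => /andP[h1 h2].
    have h3 : nrm (A x) * nrm x <= C * nrm x ^+ 2 by rewrite expr2 mulrA ler_wpM2r ?nrm_ge0.
    by rewrite /w expr0; apply/andP; split; lra.
  by move=> k; rewrite mulr1; case: (cQ k).
pose T := {ns : nat * (bop H * R) | good ns.1 ns.2}.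
pose rel (s t : T) := (sval t).1 = (sval s).1.+1 /\
  [/\ (sval t).2.1 * (sval s).2.1 = (sval t).2.1, (sval s).2.2 <= (sval t).2.2 &
     (sval t).2.2 + w (sval s).1.+1 <= (sval s).2.2 + w (sval s).1].
have [[[n s] gs]|f [f0 fS]] :=
    @dependent_choice T rel _ (exist _ (0%N, (1, - C)) good0).
  by have /cid[s' [gs' hs']] := step n s gs; exists (exist _ (n.+1, s') gs').
have f1 n : (sval (f n)).1 = n.
  by elim: n => [|n IH]; [rewrite f0|have [-> _] := fS n; rewrite IH].
pose F n := (sval (f n)).2.1; pose l n := (sval (f n)).2.2.
have gF n : good n (F n, l n).
  by have := svalP (f n); rewrite f1 /F /l; case: (sval (f n)).2.
have FS n : F n.+1 * F n = F n.+1 by case: (fS n) => _ [].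
have lS : nondecreasing_seq l.
  by apply/nondecreasing_seqP => n; case: (fS n) => _ [].
have lwS : nonincreasing_seq (fun n => l n + w n).
  by apply/nonincreasing_seqP => n; case: (fS n) => _ []; rewrite f1.
have lw n m : l m <= l n + w n.
  have [mn|nm] := leqP m n; first by rewrite (le_trans (lS _ _ mn)) // lerDl ltW.
  by rewrite (le_trans _ (lwS _ _ (ltnW nm))) // lerDl ltW.
(* The left endpoints increase and the right endpoints decrease; [a] is the
   common point of the intervals. *)
pose a := sup (range l).
have la n : l n <= a.
  by apply: ub_le_sup; [exists (l 0%N + w 0%N) => _ [m _ <-]|exists n].
have alw n : a <= l n + w n.
  by apply: ge_sup; [exists (l 0%N), 0%N|move=> _ [m _ <-]].
have commFQ n k : GRing.comm (F n) (Q k).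
  by case: (gF n) => _ /(_ (Q k)) h _ _; apply/commr_sym/h/commr_sym.
have pQF k : projection (Q k * F k).
  by apply: projectionM; [case: (cQ k)|case: (gF k)|apply/commr_sym].
exists a, (4 * C), (fun k => Q k * F k); split.
- move=> k; split=> //; first by case: (gF k).
  rewrite -mulrA [F k.+1 * _]mulrA commFQ -mulrA FS mulrA.
  by case: (cQ k) => _ _ ->.
- by move=> k; rewrite mulrA; case: (cQ k) => -[_ ->].
- move=> Z ZA ZQ k; apply: commrM => //.
  by case: (gF k) => _ /(_ Z ZA).
move=> k x QFx.
have Fx : F k x = x.
  rewrite -{1}QFx -bopME mulrA commFQ -mulrA.
  by case: (gF k) => -[_ ->] _ _ _; exact: QFx.
have AF : GRing.comm A (F k) by case: (gF k) => _ /(_ A erefl).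
have hF : forall x, F k x = x ->
    l k * nrm x ^+ 2 <= ip (A x) x <= (l k + w k) * nrm x ^+ 2.
  by case: (gF k).
have h1 := numeric_range_bound sA AF (w0 k) hF Fx.
have -> : A x - a%:C *: x = (A x - (l k)%:C *: x) - (a - l k)%:C *: x.
  by rewrite rmorphB /= scalerBl opprB addrA subrK.
rewrite (le_trans (nrmB _ _)) // nrmZr ger0_norm ?subr_ge0 //.
have h2 : (a - l k) * nrm x <= w k * nrm x.
  by rewrite ler_wpM2r ?nrm_ge0 // lerBlDl alw.
by move: h1 h2; rewrite /w; lra.
Qed.

End Localisation.

(** * Joint approximate eigenvectors *)

(** [comm] reduces commutation of two polynomial expressions to commutation
    of their letters, looked up in the context in either order. *)
Ltac comm_right tac :=
  first [ exact: commr1 | exact: commr0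
        | apply: commrD; comm_right tac | apply: commrN; comm_right tac
        | apply: commrM; comm_right tac | apply: commZ; comm_right tac | tac ].
Ltac comm_atom := first [ done | by apply: commr_sym ].
Ltac comm := comm_right ltac:(apply: commr_sym; comm_right comm_atom).

Section JointSpectrum.
Variables (R : realType) (H : hilbert R).
Implicit Types (S T A B P E Z : bop H) (Q : nat -> bop H) (x y z : H) (r : R).
Implicit Types (s t p : R[i]) (u : nat -> H).

Lemma localise_seq (As : seq (bop H)) Q : chain Q ->
  (forall A, A \in As -> selfadj A /\ forall k, GRing.comm A (Q k)) ->
  (forall A B, A \in As -> B \in As -> GRing.comm A B) ->
  exists Q', [/\ chain Q', forall k, Q k * Q' k = Q' k &
    forall A, A \in As -> exists (a D : R), forall k x, Q' k x = x ->
      nrm (A x - a%:C *: x) <= D * (1/2) ^+ k * nrm x].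
Proof.
elim: As Q => [|A As IH] Q cQ hA hAs.
  by exists Q; split=> // k; case: (cQ k) => -[].
have [sA AQ] := hA A (mem_head _ _).
have [a [D [Q1 [cQ1 QQ1 comm1 hQ1]]]] := localise cQ sA AQ.
have [|B C|Q2 [cQ2 Q12 hQ2]] := IH Q1 cQ1.
- move=> B BAs; have BAAs : B \in A :: As by rewrite inE BAs orbT.
  have [sB BQ] := hA B BAAs; split=> //; apply: comm1 => //.
  by apply: hAs => //; apply: mem_head.
- by move=> BAs CAs; apply: hAs; rewrite inE ?BAs ?CAs orbT.
exists Q2; split=> // [k|B].
  by rewrite -(Q12 k) mulrA QQ1.
rewrite inE => /predU1P[->|/hQ2//].
exists a, D => k x Q2x; apply: hQ1.
by rewrite -{1}Q2x -bopME Q12.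
Qed.

(** The rate [8^-k] beats the size [4^-k] of the humps in [gliding_hump]. *)
Definition approx_eigen u T t :=
  exists D : R, forall k, nrm (T (u k) - t *: u k) <= D * (1/8) ^+ k.

Lemma approx_eigenD u S T s t : approx_eigen u S s -> approx_eigen u T t ->
  approx_eigen u (S + T) (s + t).
Proof.
move=> [C hC] [D hD]; exists (C + D) => k.
rewrite mulrDl bopDE scalerDl opprD addrACA.
by rewrite (le_trans (nrmD _ _)) // lerD.
Qed.

Lemma approx_eigenZ u T t s : approx_eigen u T t -> approx_eigen u (s *: T) (s * t).
Proof.
move=> [D hD]; exists (complex.Re `|s| * D) => k.
rewrite bopZE -scalerA -scalerBr nrmZ -mulrA ler_wpM2l //.
by rewrite -ler0c RRe_real ?normr_real.
Qed.

Lemma approx_eigen_id u : approx_eigen u 1 1.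
Proof. by exists 0 => k; rewrite bop1E scale1r subrr nrm0 mul0r. Qed.

Lemma approx_eigenB u S T s t : approx_eigen u S s -> approx_eigen u T t ->
  approx_eigen u (S - T) (s - t).
Proof.
move=> hS hT; apply: approx_eigenD => //.
by rewrite -(scaleN1r T) -(mulN1r t); apply: approx_eigenZ.
Qed.

Lemma approx_eigenM u S T s t : approx_eigen u S s -> approx_eigen u T t ->
  approx_eigen u (S * T) (s * t).
Proof.
move=> [C hC] [D hD]; have [K K0 hK] := bop_bound S.
exists (K * D + complex.Re `|t| * C) => k.
have -> : (S * T) (u k) - (s * t) *: u k =
    S (T (u k) - t *: u k) + t *: (S (u k) - s *: u k).
  by rewrite bopME opB opZ scalerBr scalerA (mulrC t) addrA subrK.
rewrite (le_trans (nrmD _ _)) // mulrDl -!mulrA lerD //.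
  by rewrite (le_trans (hK _)) // ler_wpM2l // ltW.
by rewrite nrmZ ler_wpM2l // -ler0c RRe_real ?normr_real.
Qed.

(** The remainder tends to 0 along the sequence. *)
Lemma approx_eigen_bound u T t r : (forall k, nrm (u k) = 1) ->
  (forall k, r <= nrm (T (u k))) -> approx_eigen u T t -> r <= complex.Re `|t|.
Proof.
move=> u1 hT [D hD]; apply/ler_addgt0Pr => e e0.
have [k hk] : exists k, D * (1/8) ^+ k < e.
  have : D * (1/8) ^+ k @[k --> \oo] --> (0 : R).
    rewrite -[0](mulr0 D); apply: cvgMr; apply: cvg_expr.
    by rewrite ger0_norm; lra.
  move=> /cvgrPdist_lt/(_ e e0)[k _ hk]; exists k.
  by have := hk k (leqnn k); rewrite sub0r normrN => /(le_lt_trans (ler_norm _)).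
have := nrmD (T (u k) - t *: u k) (t *: u k); rewrite subrK nrmZ u1 mulr1.
by have := hD k; have := hT k; lra.
Qed.

Definition reop T := (1/2 : R)%:C *: (T + adj T).
Definition imop T := (0 -i* (1/2 : R)) *: (T - adj T).

Lemma reop_selfadj T : selfadj (reop T).
Proof. by apply: selfadjZ; rewrite /selfadj adjD adjK addrC. Qed.

Lemma imop_selfadj T : selfadj (imop T).
Proof.
rewrite /selfadj /imop adjZ adjB adjK -opprB scalerN -scaleNr; congr (_ *: _).
by apply/eqP; rewrite eq_complex /= !oppr0 ?opprK !eqxx.
Qed.

Lemma reop_imop T : reop T + 'i%C *: imop T = T.
Proof.
rewrite /reop /imop scalerA.
have -> : 'i%C * (0 -i* (1/2 : R)) = (1/2 : R)%:C.
  by apply/eqP; rewrite eq_complex /=; apply/andP; split; apply/eqP; ring.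
rewrite -scalerDr addrACA subrr addr0 scalerDr -scalerDl -rmorphD /=.
by rewrite (_ : 1/2 + 1/2 = 1 :> R) ?scale1r //; lra.
Qed.

Lemma reop_imop_adj T : reop T - 'i%C *: imop T = adj T.
Proof.
rewrite -[RHS](congr1 (@adj _ _) (reop_imop T)) adjD reop_selfadj adjZ imop_selfadj.
rewrite -scaleNr; congr (_ + _ *: _).
by apply/eqP; rewrite eq_complex /= oppr0 !eqxx.
Qed.

(** For [c] slightly larger than [m^2], the spectral projection of [adj T * T -
    c] is nonzero, and [T] is bounded below by the square root of [c] on its
    range. Localise the real and imaginary parts of [S] and [P] inside that
    range. *)
Lemma joint_eigenvectors S P T x (m : R) :
  GRing.comm S (adj S) -> GRing.comm P (adj P) -> GRing.comm S P ->
  GRing.comm S (adj P) -> GRing.comm (adj T * T) S -> GRing.comm (adj T * T) P ->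
  0 <= m -> m * nrm x < nrm (T x) ->
  exists u s p r, [/\ m < r, forall k, nrm (u k) = 1, forall k, r <= nrm (T (u k)),
    approx_eigen u S s /\ approx_eigen u (adj S) (Num.conj s) &
    approx_eigen u P p /\ approx_eigen u (adj P) (Num.conj p)].
Proof.
move=> SS PP SP SP' DS DP m0 mT.
set D := adj T * T in DS DP.
have sD : selfadj D := selfadj_adjM T.
have PS' : GRing.comm P (adj S) by rewrite -(adjK P); apply/comm_adj/commr_sym.
have DS' : GRing.comm D (adj S) by apply/commr_sym/comm_selfadj => //; apply/commr_sym.
have DP' : GRing.comm D (adj P) by apply/commr_sym/comm_selfadj => //; apply/commr_sym.
have PS'' : GRing.comm (adj P) (adj S) by apply/comm_adj/commr_sym.
have x0 : 0 < nrm x.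
  rewrite lt_neqAle nrm_ge0 andbT eq_sym; apply/eqP => /nrm_eq0 e.
  by move: mT; rewrite e op0 nrm0 mulr0 ltxx.
have [c mc cT] : exists2 c : R, m ^+ 2 < c & c * nrm x ^+ 2 < nrm (T x) ^+ 2.
  have : m ^+ 2 < (nrm (T x) / nrm x) ^+ 2.
    by rewrite ltr_sqr ?nnegrE ?divr_ge0 ?nrm_ge0 // ltr_pdivlMr.
  set q := (_ / _) ^+ 2 => mq; exists ((m ^+ 2 + q) / 2); first by lra.
  have -> : nrm (T x) ^+ 2 = q * nrm x ^+ 2 by rewrite -exprMn divfK // gt_eqF.
  by rewrite ltr_pM2r ?exprn_gt0 //; lra.
have ipD y : ip ((D - c%:C *: (1 : bop H)) y) y = nrm (T y) ^+ 2 - c * nrm y ^+ 2.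
  by rewrite !bopE ipBl ipZl -adjP' !ip_nrm.
have sDc : selfadj (D - c%:C *: (1 : bop H)).
  by apply: selfadjB => //; apply: selfadjZ; apply: selfadj1.
have [E [pE commE hE1 hE2]] := spectral_projection sDc.
have commE' Z : GRing.comm Z D -> GRing.comm Z E.
  by move=> ZD; apply/commE/commrB => //; apply/commZ/commr1.
have E0 : E != 0.
  apply/eqP => E0; have := hE2 x; rewrite E0 ipD bop0E => /(_ erefl).
  have x00 : x != 0 by apply: contraTneq x0 => ->; rewrite nrm0 ltxx.
  by move=> /(_ x00); lra.
have cE : chain (fun=> E) by move=> k; split=> //; case: pE.
have ES : GRing.comm E S by apply/commr_sym/commE'/commr_sym.
have EP : GRing.comm E P by apply/commr_sym/commE'/commr_sym.
have ES' : GRing.comm E (adj S) by apply/commr_sym/commE'/commr_sym.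
have EP' : GRing.comm E (adj P) by apply/commr_sym/commE'/commr_sym.
pose As := [:: reop S; imop S; reop P; imop P].
have [||Q [cQ EQ hQ]] := @localise_seq As _ cE.
- move=> A; rewrite !inE => /or4P[]/eqP->; split;
    first [exact: reop_selfadj | exact: imop_selfadj | move=> _; rewrite /reop /imop; comm].
- by move=> A B; rewrite !inE => /or4P[]/eqP-> /or4P[]/eqP->;
    rewrite /reop /imop; comm.
(* The index [3 * k] turns the rate [2^-k] of the chain into [8^-k]. *)
have ex k : exists y, Q (3 * k)%N y = y /\ nrm y = 1.
  have [[sQ QQ] /op_neq0[y Qy] _] := cQ (3 * k)%N.
  have n0 : nrm (Q (3 * k)%N y) != 0 by apply: contra_neq Qy => /nrm_eq0.
  exists ((nrm (Q (3 * k)%N y))^-1%:C *: Q (3 * k)%N y).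
  by rewrite opZ -bopME QQ nrmZr normfV ger0_norm ?nrm_ge0 // mulVf.
have [u hu] := choice ex.
have apQ A : A \in As -> exists a : R, approx_eigen u A a%:C.
  move=> /hQ[a [C hC]]; exists a, C => k; have [Qu u1] := hu k.
  have := hC _ _ Qu; rewrite u1 mulr1.
  suff -> : (1/2 : R) ^+ (3 * k) = (1/8) ^+ k by [].
  by rewrite exprM; congr (_ ^+ _); field.
have [a ha] := apQ (reop S) ltac:(by rewrite !inE eqxx).
have [b hb] := apQ (imop S) ltac:(by rewrite !inE eqxx !orbT).
have [c' hc] := apQ (reop P) ltac:(by rewrite !inE eqxx !orbT).
have [d hd] := apQ (imop P) ltac:(by rewrite !inE eqxx !orbT).
exists u, (a +i* b), (c' +i* d), (Num.sqrt c).
have cjE (e f : R) : (e +i* f = e%:C + 'i%C * f%:C) /\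
    (Num.conj (e +i* f) = e%:C - 'i%C * f%:C).
  by split; apply/eqP; rewrite eq_complex /=; apply/andP; split; apply/eqP; ring.
have c0 : 0 <= c by rewrite (le_trans (sqr_ge0 m)) // ltW.
split.
- by rewrite -ltr_sqr ?nnegrE ?sqrtr_ge0 // sqr_sqrtr.
- by move=> k; case: (hu k).
- move=> k; have [Qu u1] := hu k.
  rewrite -ler_sqr ?nnegrE ?sqrtr_ge0 ?nrm_ge0 // sqr_sqrtr // -subr_ge0.
  have Eu : E (u k) = u k by rewrite -{1}Qu -bopME EQ.
  by have := hE1 _ Eu; rewrite ipD u1 expr1n mulr1.
- have [-> ->] := cjE a b; split.
    by rewrite -(reop_imop S); apply: approx_eigenD => //; apply: approx_eigenZ.
  by rewrite -(reop_imop_adj S); apply: approx_eigenB => //; apply: approx_eigenZ.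
- have [-> ->] := cjE c' d; split.
    by rewrite -(reop_imop P); apply: approx_eigenD => //; apply: approx_eigenZ.
  by rewrite -(reop_imop_adj P); apply: approx_eigenB => //; apply: approx_eigenZ.
Qed.

End JointSpectrum.

(** * Fuglede's theorem *)

Section Fuglede.
Variables (R : realType) (H : hilbert R).
Implicit Types (S T A B P E N Z : bop H) (x y z : H) (a b r : R).

Definition normal T := GRing.comm T (adj T).

Lemma normal_nrm T x : normal T -> nrm (adj T x) = nrm (T x).
Proof.
move=> nT; apply/eqP; rewrite -(@eqrXn2 _ 2) ?nrm_ge0 // -!ip_nrm.
by rewrite -adjP' [X in _ == X]adjP -!bopME nT.
Qed.

Lemma adjX T n : adj (T ^+ n) = adj T ^+ n.
Proof. by elim: n => [|n IH]; rewrite ?adj1 // exprSr adjM IH exprS. Qed.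

Lemma normalX T n : normal T -> normal (T ^+ n).
Proof. by move=> nT; rewrite /normal adjX; apply/commrX/commr_sym/commrX/commr_sym. Qed.

Lemma comm_of_invariant S E : projection E -> S * E = E * S * E ->
  adj S * E = E * adj S * E -> GRing.comm S E.
Proof.
move=> [sE _] h /(congr1 (@adj _ _)); rewrite !adjM !adjK sE mulrA => h'.
by rewrite /GRing.comm h -h'.
Qed.

Lemma geometric_vanish (C t e : R) : 0 <= t < 1 -> (forall n, e <= C * t ^+ n) -> e <= 0.
Proof.
move=> /andP[t0 t1] h; have c : C * t ^+ n @[n --> \oo] --> (0 : R).
  by rewrite -[0](mulr0 C); apply: cvgMr; apply: cvg_expr; rewrite ger0_norm.
rewrite -(cvg_lim _ c) //; apply: limr_ge; first by apply/cvg_ex; exists 0.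
exact: nearW.
Qed.

Lemma normal_log_convex N y : normal N ->
  nrm (N y) ^+ 2 <= nrm y * nrm (N (N y)).
Proof.
by move=> nN; rewrite -ip_nrm adjP (le_trans (ip_le _ _)) // normal_nrm.
Qed.

(** By log-convexity the ratios [|N^(n+1) y| / |N^n y|] do not decrease, so a
    first ratio above [r] persists. *)
Lemma normal_growth N r y : normal N -> 0 < r -> r * nrm y < nrm (N y) ->
  forall C, ~ forall n, nrm ((N ^+ n) y) <= C * r ^+ n.
Proof.
move=> nN r0 rN C hC.
have y0 : 0 < nrm y.
  rewrite lt_neqAle nrm_ge0 andbT eq_sym; apply/eqP => /nrm_eq0 e.
  by move: rN; rewrite e op0 nrm0 mulr0 ltxx.
pose q := nrm (N y) / nrm y.
have rq : r < q by rewrite ltr_pdivlMr.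
have q0 : 0 < q := lt_trans r0 rq.
pose b n := nrm ((N ^+ n) y).
have bS n : b n.+1 = nrm (N ((N ^+ n) y)) by rewrite /b exprS.
have step n : 0 < b n /\ q * b n <= b n.+1.
  elim: n => [|n [b0 IH]].
    by rewrite bS /b expr0 bop1E; split => //; rewrite divfK // gt_eqF.
  have b1 : 0 < b n.+1 by apply: lt_le_trans IH; rewrite mulr_gt0.
  split=> //; have := normal_log_convex ((N ^+ n) y) nN.
  have e2 : nrm (N (N ((N ^+ n) y))) = b n.+2 by rewrite bS exprS.
  rewrite e2 -bS -/(b n) => h.
  by rewrite -(ler_pM2l b0); nra.
have grow n : q ^+ n * b 0%N <= b n.
  elim: n => [|n IH]; first by rewrite expr0 mul1r.
  have [_ h] := step n; apply: le_trans h.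
  by rewrite exprS -mulrA ler_pM2l.
have [+ _] := step 0%N; rewrite ltNge => /negP; apply.
apply: (@geometric_vanish C (r / q)).
  by rewrite divr_ge0 ?(ltW r0) ?(ltW q0) //= ltr_pdivrMr // mul1r.
move=> n; rewrite expr_div_n mulrA ler_pdivlMr ?exprn_gt0 // mulrC.
exact: le_trans (grow n) (hC n).
Qed.

(** The spectral projection [E] of [r^2 - adj N * N] has as range the vectors
    [x] with [|N^n x| = O(r^n)].  This growth condition is preserved by the
    operators commuting with [N], and by their adjoints because [N^n] and its
    adjoint have equal norms on every vector. *)
Lemma growth_projection N r : normal N -> 0 < r ->
  exists E, [/\ projection E, forall Z, GRing.comm Z (adj N * N) -> GRing.comm Z E,
    forall x, E x = x -> nrm (N x) ^+ 2 <= r ^+ 2 * nrm x ^+ 2,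
    forall x, E x = 0 -> r ^+ 2 * nrm x ^+ 2 <= nrm (N x) ^+ 2 &
    forall S, GRing.comm S N -> GRing.comm S E].
Proof.
move=> nN r0.
pose A := (r ^+ 2)%:C *: (1 : bop H) - adj N * N.
have sA : selfadj A.
  apply: selfadjB; last exact: selfadj_adjM.
  by apply: selfadjZ; apply: selfadj1.
have ipA x : ip (A x) x = r ^+ 2 * nrm x ^+ 2 - nrm (N x) ^+ 2.
  by rewrite !bopE ipBl ipZl -adjP' !ip_nrm.
have [E [pE commE hE1 hE2]] := spectral_projection sA.
have commE' Z : GRing.comm Z (adj N * N) -> GRing.comm Z E.
  by move=> h; apply/commE/commrB => //; apply/commZ/commr1.
have EN : GRing.comm E N.
  by apply/commr_sym/commE'/commrM => //.
have h1 x : E x = x -> nrm (N x) ^+ 2 <= r ^+ 2 * nrm x ^+ 2.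
  by move=> /hE1; rewrite ipA subr_ge0.
have h1' x : E x = x -> nrm (N x) <= r * nrm x.
  by move=> /h1; rewrite -exprMn -nrm_le_sqr // mulr_ge0 ?nrm_ge0 // ltW.
have fixN x n : E x = x -> E ((N ^+ n) x) = (N ^+ n) x.
  by move=> Ex; rewrite -bopME (commrX n EN) bopME Ex.
have grow x n : E x = x -> nrm ((N ^+ n) x) <= r ^+ n * nrm x.
  move=> Ex; elim: n => [|n IH]; first by rewrite expr0 mul1r.
  rewrite exprS bopME (le_trans (h1' _ (fixN _ _ Ex))) // exprS -mulrA.
  by rewrite ler_wpM2l // ltW.
have grow_fix x C : (forall n, nrm ((N ^+ n) x) <= C * r ^+ n) -> E x = x.
  move=> hC; apply/eqP; rewrite eq_sym -subr_eq0; set y := x - E x.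
  apply/negPn/negP => y0.
  have EEx : E (E x) = E x by rewrite -bopME; case: pE => _ ->.
  have Ey : E y = 0 by rewrite opB EEx subrr.
  have ry : r * nrm y < nrm (N y).
    rewrite -ltr_sqr ?nnegrE ?mulr_ge0 ?nrm_ge0 ?(ltW r0) // exprMn -subr_lt0.
    by have := hE2 _ Ey y0; rewrite ipA; lra.
  apply: (normal_growth nN r0 ry (C := C + nrm (E x))) => n.
  rewrite opB (le_trans (nrmB _ _)) // mulrDl lerD // mulrC.
  exact: grow.
exists E; split=> //.
  move=> x Ex; have := hE2 x Ex; rewrite ipA.
  have [->|_ /(_ isT)] := eqVneq x 0; last by lra.
  by rewrite op0 nrm0 expr0n /= mulr0.
move=> S SN; apply: comm_of_invariant => //; apply: bop_ext => x; rewrite !bopE.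
  have [K K0 hK] := bop_bound S; set z := E x.
  have Ez : E z = z by rewrite -bopME; case: pE => _ ->.
  apply/esym/(grow_fix _ (K * nrm z)) => n.
  rewrite -bopME -(commrX n SN) bopME (le_trans (hK _)) // -mulrA ler_wpM2l ?(ltW K0) //.
  by rewrite mulrC grow.
have [K K0 hK] := bop_bound (adj S); set z := E x.
have Ez : E z = z by rewrite -bopME; case: pE => _ ->.
apply/esym/(grow_fix _ (K * nrm z)) => n.
rewrite -(normal_nrm _ (normalX n nN)) adjX.
rewrite -bopME -(commrX n (comm_adj SN)) bopME (le_trans (hK _)) //.
rewrite -mulrA ler_wpM2l ?(ltW K0) // mulrC -adjX normal_nrm ?grow //.
exact: normalX.
Qed.

Lemma pythagoras E x : projection E -> nrm x ^+ 2 = nrm (E x) ^+ 2 + nrm (x - E x) ^+ 2.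
Proof.
move=> [sE EE].
have h : ip (E x) (x - E x) = 0.
  by rewrite ipBr (selfadjP sE x (E x)) -bopME EE (selfadjP sE) subrr.
have -> : nrm x = nrm (E x + (x - E x)) by rewrite addrC subrK.
by rewrite nrmD_sqr h mulr0 addr0.
Qed.

(** The commutator [C] of [S] and [A = adj N * N] equals that of [S] and [A -
    a]; where [A] lies between [a] and [b], its norm is thus at most [2 |S| (b
    - a)]. Since [C] commutes with the projections of [growth_projection],
    splitting at the midpoint halves this bound, indefinitely. *)
Lemma comm_modulus N S : normal N -> GRing.comm S N -> GRing.comm S (adj N * N).
Proof.
move=> nN SN; set A := adj N * N.
have sA : selfadj A := selfadj_adjM N.
have ipA x : ip (A x) x = nrm (N x) ^+ 2 by rewrite bopME -adjP' ip_nrm.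
have [K K0 hK] := bop_bound S.
(* [n] halvings of the interval divide the bound by [2^n]. *)
pose C := S * A - A * S.
have key n : forall Q a b, projection Q -> GRing.comm Q A -> GRing.comm Q S ->
    0 <= a < b ->
    (forall x, Q x = x -> a * nrm x ^+ 2 <= ip (A x) x <= b * nrm x ^+ 2) ->
    forall x, Q x = x -> nrm (C x) <= 2 * K * (b - a) * (1/2) ^+ n * nrm x.
  elim: n => [|n IH] Q a b pQ QA QS /andP[a0 ab] hQ x Qx.
    have QSx : Q (S x) = S x by rewrite -bopME QS bopME Qx.
    have hQ' y : Q y = y -> a * nrm y ^+ 2 <= ip (A y) y <= (a + (b - a)) * nrm y ^+ 2.
      by rewrite addrC subrK; apply: hQ.
    have ba : 0 < b - a by rewrite subr_gt0.
    have h1 := numeric_range_bound sA (commr_sym QA) ba hQ' Qx.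
    have h2 := numeric_range_bound sA (commr_sym QA) ba hQ' QSx.
    have -> : C x = S (A x - a%:C *: x) - (A (S x) - a%:C *: S x).
      by rewrite /C !bopE opB opZ opprB addrA subrK.
    rewrite (le_trans (nrmB _ _)) // expr0 mulr1.
    have h3 := hK (A x - a%:C *: x); have h4 := hK x.
    have h5 : K * nrm (A x - a%:C *: x) <= K * ((b - a) * nrm x) by rewrite ler_pM2l.
    have h6 : (b - a) * nrm (S x) <= (b - a) * (K * nrm x) by rewrite ler_pM2l.
    by lra.
  pose m := (a + b) / 2.
  have m0 : 0 < m by rewrite /m; lra.
  have r0 : 0 < Num.sqrt m by rewrite sqrtr_gt0.
  have [E [pE commE hE1 hE2 SE]] := growth_projection nN r0.
  rewrite sqr_sqrtr ?(ltW m0) // in hE1 hE2.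
  have ES : GRing.comm E S by apply/commr_sym/SE.
  have EA : GRing.comm E A by apply/commr_sym/commE.
  have EQ : GRing.comm Q E by apply: commE.
  have EC : GRing.comm E C by apply: commrB; apply: commrM.
  pose y := E x; pose z := x - E x.
  have Qy : Q y = y by rewrite -bopME EQ bopME Qx.
  have Qz : Q z = z by rewrite opB Qx -/y Qy.
  have Ey : E y = y by rewrite -bopME; case: pE => _ ->.
  have Ez : E z = 0 by rewrite opB -/y Ey subrr.
  have hy : nrm (C y) <= 2 * K * (m - a) * (1/2) ^+ n * nrm y.
    apply: (IH (Q * E)).
    - exact: projectionM.
    - by apply/commr_sym/commrM; apply/commr_sym.
    - by apply/commr_sym/commrM; apply/commr_sym.
    - by rewrite a0 /m /=; lra.
    - move=> w Qw; have Qw' : Q w = w /\ E w = w.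
        split; rewrite -{1}Qw -bopME; first by rewrite mulrA; case: pQ => _ ->.
        by rewrite mulrA -EQ -mulrA; case: pE => _ ->.
      have /andP[-> _] := hQ _ Qw'.1; rewrite ipA /=; exact: hE1 Qw'.2.
    - by rewrite bopME Ey Qy.
  have hz : nrm (C z) <= 2 * K * (b - m) * (1/2) ^+ n * nrm z.
    have pF := projectionC pE.
    have QF : GRing.comm Q (1 - E) by apply: commrB => //; apply: commr1.
    apply: (IH (Q * (1 - E))).
    - exact: projectionM.
    - by comm.
    - by comm.
    - by rewrite (ltW m0) /m /=; lra.
    - move=> w Qw; have Qw' : Q w = w /\ (1 - E) w = w.
        split; rewrite -{1}Qw -bopME; first by rewrite mulrA; case: pQ => _ ->.
        by rewrite mulrA -QF -mulrA; case: pF => _ ->.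
      have /andP[_ ->] := hQ _ Qw'.1; rewrite ipA andbT; apply: hE2.
      exact: projC_fix Qw'.2.
    - by rewrite bopME bopBE bop1E Ez subr0 Qz.
  have mE : m - a = (b - a) / 2 /\ b - m = (b - a) / 2 by rewrite /m; split; lra.
  rewrite mE.1 in hy; rewrite mE.2 in hz.
  have -> : 2 * K * (b - a) * (1/2) ^+ n.+1 = 2 * K * ((b - a) / 2) * (1/2) ^+ n.
    by rewrite exprS; field.
  set L := _ * _ ^+ n in hy hz *.
  have L0 : 0 <= L.
    by rewrite !mulr_ge0 ?exprn_ge0 ?(ltW K0) ?subr_ge0 ?(ltW ab).
  clearbody L.
  rewrite nrm_le_sqr ?mulr_ge0 ?nrm_ge0 // exprMn (pythagoras (C x) pE) (pythagoras x pE).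
  have -> : E (C x) = C y by rewrite -bopME EC.
  have -> : C x - C y = C z by rewrite -opB.
  rewrite mulrDr -!exprMn -/y -/z.
  by rewrite lerD // ler_sqr ?nnegrE ?mulr_ge0 ?nrm_ge0.
have [D D0 hD] := bop_bound N.
apply: bop_ext => x; apply/eqP; rewrite -subr_eq0 -bopBE -/C.
apply/eqP/nrm_eq0/eqP; rewrite eq_le nrm_ge0 andbT.
apply: (@geometric_vanish (2 * K * (D ^+ 2) * nrm x) (1/2)); first by apply/andP; split; lra.
move=> n; rewrite mulrAC -[D ^+ 2]subr0; apply: (key n 1) => //.
- by split; [exact: selfadj1|rewrite mulr1].
- exact/commr_sym/commr1.
- exact/commr_sym/commr1.
- by rewrite lexx exprn_gt0.
- move=> y _; rewrite ipA mul0r sqr_ge0 /= -exprMn ler_sqr ?nnegrE ?mulr_ge0 ?nrm_ge0 //.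
  exact: ltW.
Qed.

(** [adj P] is a combination of [P], [adj P * P] and [adj (P - 1) * (P - 1)]. *)
Theorem fuglede S P : normal P -> GRing.comm S P -> GRing.comm S (adj P).
Proof.
move=> nP SP.
have n1 : normal (P - 1) by rewrite /normal adjB adj1; comm.
have h0 := comm_modulus nP SP.
have S1 : GRing.comm S (P - 1) by comm.
have h1 := comm_modulus n1 S1.
have -> : adj P = adj P * P - P + 1 - adj (P - 1) * (P - 1).
  by rewrite adjB adj1 mulrBr mulr1 mulrBl mul1r opprB addrC subrKA subrK.
by apply: commrB => //; apply: commrD; [apply: commrB|apply: commr1].
Qed.

End Fuglede.

(** * Square roots of unitaries and the unitary summand *)

Section UnitaryConstruction.
Variables (R : realType) (H : hilbert R).
Implicit Types (S T A B C P Q U V Z c t : bop H) (x y z : H).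

Definition unitary U := adj U * U = 1 /\ U * adj U = 1.

Lemma unitary_adj U : unitary U -> unitary (adj U).
Proof. by move=> [h1 h2]; split; rewrite adjK. Qed.

Lemma unitary_nrm U x : unitary U -> nrm (U x) = nrm x.
Proof.
move=> [h _]; apply/eqP; rewrite -(@eqrXn2 _ 2) ?nrm_ge0 // -!ip_nrm.
by rewrite adjP -bopME h.
Qed.

Lemma unitaryM U V : unitary U -> unitary V -> unitary (U * V).
Proof.
move=> [h1 h2] [h3 h4]; split; rewrite adjM.
  by rewrite mulrA -(mulrA (adj V)) h1 mulr1.
by rewrite mulrA -(mulrA U) h4 mulr1.
Qed.

Lemma unitary_comm P Z : unitary P -> GRing.comm Z P -> GRing.comm Z (adj P).
Proof.
move=> [h1 h2] ZP; rewrite /GRing.comm -[LHS]mul1r -h1.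
by rewrite mulrA -(mulrA (adj P)) -ZP mulrA -(mulrA _ P) h2 mulr1.
Qed.

Lemma mulr_i T : 'i%C *: ('i%C *: T) = - T.
Proof.
rewrite scalerA -scaleN1r; congr (_ *: _).
by apply/eqP; rewrite eq_complex /=; apply/andP; split; apply/eqP; ring.
Qed.

Lemma adj_i T : adj ('i%C *: T) = - ('i%C *: adj T).
Proof.
rewrite adjZ -scaleNr; congr (_ *: _).
by apply/eqP; rewrite eq_complex /= oppr0 !eqxx.
Qed.

Lemma cis_adj c t : selfadj c -> selfadj t -> adj (c + 'i%C *: t) = c - 'i%C *: t.
Proof. by move=> sc st; rewrite adjD adj_i sc st. Qed.

Lemma cis_conjM c t : GRing.comm c t ->
  (c - 'i%C *: t) * (c + 'i%C *: t) = c * c + t * t.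
Proof.
move=> ct; rewrite mulrBl !mulrDr bop_scaler !bop_scalel bop_scaler mulr_i ct.
by rewrite opprB addrA addrAC addrK.
Qed.

(** Operator form of [cos + i sin]. *)
Lemma cis_unitary c t : selfadj c -> selfadj t -> GRing.comm c t ->
  c * c + t * t = 1 -> unitary (c + 'i%C *: t).
Proof.
move=> sc st ct h; rewrite /unitary cis_adj //; split; first by rewrite cis_conjM.
have -> : (c + 'i%C *: t) * (c - 'i%C *: t) = (c - 'i%C *: t) * (c + 'i%C *: t).
  by rewrite -/(GRing.comm _ _); comm.
by rewrite cis_conjM.
Qed.

Lemma cis_sq c t : GRing.comm c t ->
  (c + 'i%C *: t) * (c + 'i%C *: t) = (c * c - t * t) + 'i%C *: (c * t + c * t).
Proof.
move=> ct; rewrite mulrDl !mulrDr bop_scaler !bop_scalel bop_scaler mulr_i -ct.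
by rewrite scalerDr [RHS]addrAC !addrA.
Qed.

Lemma half_sum T : (1/2 : R)%:C *: T + (1/2 : R)%:C *: T = T.
Proof. by rewrite -scalerDl -rmorphD /= (_ : 1/2 + 1/2 = 1 :> R) ?scale1r //; lra. Qed.

Lemma double T : (2 : R)%:C *: T = T + T.
Proof.
rewrite -(half_sum (_ *: T)) scalerA; suff -> : (1/2 : R)%:C * (2 : R)%:C = 1.
  by rewrite scale1r.
by apply/eqP; rewrite eq_complex /=; apply/andP; split; apply/eqP; field.
Qed.

(** [T] is the reflection fixing the kernel of [K - C].  As [(K - C) * (K + C)
    = 0], it fixes [K + C], and it negates [K - C]. *)
Lemma sign_factor K C : selfadj K -> selfadj C -> GRing.comm K C -> K * K = C * C ->
  exists T, [/\ selfadj T, T * T = 1, T * K = C &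
    forall Z, GRing.comm Z K -> GRing.comm Z C -> GRing.comm Z T].
Proof.
move=> sK sC KC KK.
have [Q [[sQ QQ] NQ Qfix commQ]] := kernel_projection (selfadjB sK sC).
have QK : GRing.comm Q K by apply/commr_sym/commQ; comm.
have NKC : (K - C) * (K + C) = 0.
  by rewrite mulrDr !mulrBl KK KC addrA subrK subrr.
have QKC : Q * (K + C) = K + C.
  by apply: bop_ext => x; rewrite bopME Qfix // -bopME NKC.
have KQ : K * Q = C * Q by move: NQ; rewrite mulrBl => /subr0_eq.
have QC : GRing.comm Q C by apply/commr_sym/commQ; comm.
exists (Q + Q - 1); split.
- by apply: selfadjB; [apply: selfadjD|apply: selfadj1].
- by rewrite mulrBr mulr1 mulrBl !mulrDl !mulrDr mul1r QQ addrK opprB addrC subrK.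
- by rewrite mulrBl mul1r mulrDl {2}QK KQ -QC -mulrDr QKC addrAC subrr add0r.
- by move=> Z ZK ZC; have ZQ : GRing.comm Z Q by [apply: commQ; apply: commrB]; comm.
Qed.

(** Half-angle formulas.  If [P = C + i D], let [c] and [s] be the square roots
    of [(1 + C) / 2] and [(1 - C) / 2].  Then the square of [2 c s] is [1 - C^2
    = D^2], so a reflection [T] turns [2 c s] into [D], and the square of [c +
    i T s] is [P]. *)
Lemma unitary_sqrt P : unitary P ->
  exists V, [/\ unitary V, V * V = P & forall Z, GRing.comm Z P -> GRing.comm Z V].
Proof.
move=> uP; have [P1 P2] := uP.
set C := reop P; set D := imop P.
have sC : selfadj C := reop_selfadj P.
have sD : selfadj D := imop_selfadj P.
have nP : GRing.comm P (adj P) by rewrite /GRing.comm P1 P2.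
have CD : GRing.comm C D by rewrite /C /D /reop /imop; comm.
have CDi : GRing.comm C ('i%C *: D) by apply: commZ.
have CC : C * C + D * D = 1.
  rewrite -P1 -(reop_imop_adj P) -[X in _ = _ * X](reop_imop P) -/C -/D.
  by rewrite cis_conjM.
have cC : contraction C.
  move=> x; rewrite nrm_le_sqr ?nrm_ge0 //.
  have : ip ((C * C + D * D) x) x = nrm x ^+ 2 by rewrite CC bop1E ip_nrm.
  rewrite bopDE !bopME ipDl (selfadjP sC) (selfadjP sD) !ip_nrm => <-.
  by rewrite lerDl sqr_ge0.
pose h : R[i] := (1/2 : R)%:C.
have cont (B : bop H) : contraction B -> contraction (h *: (1 - B)).
  move=> cB x; rewrite !bopE nrmZr ger0_norm; last by lra.
  by have := nrmB x (B x); have := cB x; lra.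
have hE B : 1 - h *: (1 + B) = h *: (1 - B).
  by rewrite scalerDr scalerBr -{1}(half_sum 1) -/h opprD addrACA subrr add0r.
have selfh B : selfadj B -> selfadj (h *: (1 + B)).
  by move=> sB; apply/selfadjZ/selfadjD => //; apply: selfadj1.
have sNC : selfadj (- C) by rewrite /selfadj adjN sC.
have cNC : contraction (- C) by move=> x; rewrite bopNE nrmN.
have [c [sc cc _ commc]] : exists c, [/\ selfadj c, c * c = h *: (1 + C),
    contraction (1 - c) & forall Z, GRing.comm Z (h *: (1 + C)) -> GRing.comm Z c].
  by apply: sqrt_exists; [exact: selfh|rewrite hE; apply: cont].
have [s [ss s2 _ comms]] : exists s, [/\ selfadj s, s * s = h *: (1 - C),
    contraction (1 - s) & forall Z, GRing.comm Z (h *: (1 - C)) -> GRing.comm Z s].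
  by apply: sqrt_exists; [exact: selfh|rewrite hE; apply: cont].
have commc' Z : GRing.comm Z C -> GRing.comm Z c by move=> ZC; apply: commc; comm.
have comms' Z : GRing.comm Z C -> GRing.comm Z s.
  move=> ZC; apply: comms; apply: commZ; apply: commrB => //; exact: commr1.
have cs : GRing.comm c s by apply/comms'/commr_sym/commc'.
have Dc : GRing.comm D c by apply/commc'/commr_sym.
have Ds : GRing.comm D s by apply/comms'/commr_sym.
pose K := (2 : R)%:C *: (c * s).
have sK : selfadj K by apply: selfadjZ; apply: selfadjM.
have KD : GRing.comm K D by rewrite /K; comm.
have KK : K * K = D * D.
  rewrite /K bop_scalel bop_scaler scalerA mulrA -(mulrA c) -cs mulrA cc -mulrA s2.
  rewrite bop_scalel bop_scaler !scalerA mulrDl mul1r mulrBr mulr1 addrA subrK.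
  rewrite (_ : 1 - C * C = D * D); last by rewrite -CC addrC addKr.
  suff -> : (2 : R)%:C * (2 : R)%:C * h * h = 1 by rewrite scale1r.
  by apply/eqP; rewrite eq_complex /=; apply/andP; split; apply/eqP; field.
have [T [sT TT TK commT]] := sign_factor sK sD KD KK.
have commK Z : GRing.comm Z C -> GRing.comm Z K.
  by move=> ZC; apply/commZ/commrM; [apply: commc'|apply: comms'].
have Tc : GRing.comm T c by apply/commr_sym/commT; [rewrite /K|]; comm.
have Ts : GRing.comm T s by apply/commr_sym/commT; [rewrite /K|]; comm.
pose t := T * s.
have st : selfadj t by apply: selfadjM.
have ct : GRing.comm c t by rewrite /t; comm.
have tt : t * t = h *: (1 - C).
  by rewrite /t mulrA -(mulrA T) -Ts mulrA TT mul1r.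
exists (c + 'i%C *: t); split.
- apply: cis_unitary => //; rewrite cc tt -scalerDr addrACA subrr addr0.
  by rewrite scalerDr half_sum.
- have e1 : c * c - t * t = C.
    by rewrite cc tt -scalerBr opprB addrC subrKA scalerDr half_sum.
  have e2 : c * t + c * t = D.
    by rewrite /t mulrA -Tc -mulrA -mulrDr -double.
  by rewrite cis_sq // e1 e2; apply: reop_imop.
- move=> Z ZP; have ZP' := unitary_comm uP ZP.
  have ZC : GRing.comm Z C by rewrite /C /reop; comm.
  have ZD : GRing.comm Z D by rewrite /D /imop; comm.
  have Zc := commc' _ ZC; have Zs := comms' _ ZC.
  have ZT : GRing.comm Z T by apply: commT => //; apply: commK.
  by rewrite /t; comm.
Qed.

(** With a square root [V] of [P], the operator [A = S * adj V / 2] is a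
    selfadjoint contraction: it plays the part of the cosine of half the
    difference of the two arguments.  The summand is [V * (A + i sqrt (1 - A *
    A))]. *)
Lemma unitary_summand S P : unitary P -> GRing.comm S P -> S = adj S * P ->
  (forall x, nrm (S x) <= 2 * nrm x) ->
  exists U, [/\ unitary U, GRing.comm U P & S = U + adj U * P].
Proof.
move=> uP SP SE S2.
have [V [uV VV commV]] := unitary_sqrt uP; have [V1 V2] := uV.
have SV : GRing.comm S V by apply: commV.
have SV' : GRing.comm S (adj V) by apply: unitary_comm.
have S'V : GRing.comm (adj S) V by rewrite -(adjK V); apply: comm_adj.
pose A := (1/2 : R)%:C *: (S * adj V).
have sA : selfadj A.
  apply: selfadjZ; rewrite /selfadj adjM adjK {2}SE -VV -mulrA -(mulrA V) V2 mulr1.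
  exact/esym.
have cA : contraction A.
  move=> x; rewrite bopZE bopME nrmZr ger0_norm; last by lra.
  by have := S2 (adj V x); rewrite (unitary_nrm _ (unitary_adj uV)); lra.
have AP : GRing.comm P A.
  have PV : GRing.comm P V by apply: commV.
  have PV' : GRing.comm P (adj V) by apply: unitary_comm.
  by rewrite /A; comm.
have AV : GRing.comm V A.
  have VV' : GRing.comm V (adj V) by rewrite /GRing.comm V1 V2.
  by rewrite /A; comm.
have [B [sB BB _ commB]] : exists B, [/\ selfadj B, B * B = 1 - A * A,
    contraction (1 - B) & forall Z, GRing.comm Z (1 - A * A) -> GRing.comm Z B].
  apply: sqrt_exists; first by apply: selfadjB; [apply: selfadj1|apply: selfadjM].
  by rewrite subKr; apply: contractionM.
have commB' Z : GRing.comm Z A -> GRing.comm Z B.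
  by move=> ZA; apply: commB; apply: commrB; [apply: commr1|apply: commrM].
pose W := A + 'i%C *: B.
have uW : unitary W.
  by apply: cis_unitary => //; [apply: commB'|rewrite BB addrC subrK].
have WE : adj W = A - 'i%C *: B by apply: cis_adj.
have VW : GRing.comm V W by have VB := commB' _ AV; rewrite /W; comm.
have VW' : GRing.comm V (adj W) by apply: unitary_comm.
exists (V * W); split; first exact: unitaryM.
  have := commB' _ AP => PB; have PV : GRing.comm P V by apply: commV.
  by rewrite /W; comm.
have WW : W + adj W = S * adj V.
  by rewrite WE /W addrACA subrr addr0 /A half_sum.
rewrite adjM -VV -mulrA (mulrA (adj V)) V1 mul1r -VW' -mulrDr WW.
by rewrite mulrA -SV -mulrA V2 mulr1.
Qed.

End UnitaryConstruction.

(** * The distinguished boundary of the symmetrized bidisc *)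

Section Scalars.
Variable R : realType.
Implicit Types (s p w z : R[i]).

Definition modulus z : R := complex.Re `|z|.

Lemma modulusE z : `|z| = (modulus z)%:C.
Proof. by rewrite /modulus RRe_real // normr_real. Qed.

Lemma modulus_ge0 z : 0 <= modulus z.
Proof. by rewrite -ler0c -modulusE. Qed.

Lemma modulusM z w : modulus (z * w) = modulus z * modulus w.
Proof. by apply: complexI; rewrite rmorphM /= -!modulusE normrM. Qed.

Lemma modulusD z w : modulus (z + w) <= modulus z + modulus w.
Proof. by rewrite -lecR rmorphD /= -!modulusE ler_normD. Qed.

Lemma modulus_sq z : modulus z ^+ 2 = complex.Re z ^+ 2 + complex.Im z ^+ 2.
Proof. by apply: complexI; rewrite rmorphXn /= -modulusE add_Re2_Im2. Qed.

Lemma modulus_eq1 z : (modulus z = 1) <-> (`|z| = 1).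
Proof. by rewrite modulusE; split => [->//|[]]. Qed.

Lemma Re_le_modulus z : complex.Re z <= modulus z.
Proof.
rewrite (le_trans (ler_norm _)) // -ler_sqr ?nnegrE ?modulus_ge0 //.
by rewrite real_normK ?num_real // modulus_sq lerDl sqr_ge0.
Qed.

Lemma modulusV z : modulus z^-1 = (modulus z)^-1.
Proof. by apply: complexI; rewrite fmorphV /= -!modulusE normfV. Qed.

Lemma sum_product_roots s p : exists z1 z2, s = z1 + z2 /\ p = z1 * z2.
Proof.
pose d := sqrtc (s ^+ 2 - 4 * p).
have dd : d ^+ 2 = s ^+ 2 - 4 * p by apply: sqr_sqrtc.
exists ((s + d) / 2), ((s - d) / 2); split; first by field.
have -> : (s + d) / 2 * ((s - d) / 2) = (s ^+ 2 - d ^+ 2) / 4 by field.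
by rewrite dd; field.
Qed.

Lemma bGamma_conditions s p : bGamma (s, p) ->
  [/\ modulus p = 1, s = Num.conj s * p & modulus s <= 2].
Proof.
move=> [[z1 z2] /= [/modulus_eq1 h1 /modulus_eq1 h2] [<- <-]]; split.
- by rewrite modulusM h1 h2 mulr1.
- have e z : modulus z = 1 -> Num.conj z * z = 1.
    by move=> hz; rewrite mulrC -normCK modulusE hz expr1n.
  rewrite rmorphD /= mulrDl mulrA e // mul1r (mulrC z1) mulrA e // mul1r.
  by rewrite addrC.
- by rewrite (le_trans (modulusD _ _)) // h1 h2; lra.
Qed.

(** Let [A] be the square of the modulus of [z1], so that [z2] has squared
    modulus [1 / A].  The second condition becomes [(z1 - A z2) (1 - A) = 0].
    If [A] were not 1, then [s = (1 + A) z2] would have modulus larger than 2. *)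
Lemma conditions_bGamma s p : modulus p = 1 -> s = Num.conj s * p -> modulus s <= 2 ->
  bGamma (s, p).
Proof.
have [z1 [z2 [-> ->]]] := sum_product_roots s p.
move=> hp hs h2; exists (z1, z2) => //=.
suff [h3 h4] : modulus z1 = 1 /\ modulus z2 = 1 by split; apply/modulus_eq1.
have p1 := modulus_ge0 z1; have p2 := modulus_ge0 z2; have ps := modulus_ge0 (z1 + z2).
rewrite modulusM in hp.
have hs2 : modulus (z1 + z2) ^+ 2 <= 4 by nra.
have t1 := modulus_sq z1; have t2 := modulus_sq z2.
rewrite modulus_sq in hs2.
have {}hp : modulus z1 ^+ 2 * modulus z2 ^+ 2 = 1 by rewrite -exprMn hp expr1n.
suff e1 : modulus z1 ^+ 2 = 1.
  have e2 : modulus z2 ^+ 2 = 1 by move: hp; rewrite e1 mul1r.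
  by split; apply/eqP; rewrite -(@eqrXn2 _ 2) ?expr1n ?e1 ?e2.
case: z1 z2 hs {p1 p2 ps h2} hs2 t1 t2 hp => [a b] [c d] /= hs hs2 t1 t2 hp.
move: hs => /eqP; rewrite eq_complex /= => /andP[/eqP r1 /eqP r2].
set A := _ ^+ 2 in t1 hp *; set B := _ ^+ 2 in t2 hp; clearbody A B.
have {}r1 : a + c = A * c + a * B by rewrite r1 t1 t2; ring.
have {}r2 : b + d = A * d + b * B by rewrite r2 t1 t2; ring.
have e1 : (a - A * c) * (1 - A) = 0.
  have h : A * (a + c) = A * A * c + a * (A * B) by rewrite r1; ring.
  have -> : (a - A * c) * (1 - A) = A * A * c + a - A * (a + c) by ring.
  by rewrite h hp mulr1 subrr.
have e2 : (b - A * d) * (1 - A) = 0.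
  have h : A * (b + d) = A * A * d + b * (A * B) by rewrite r2; ring.
  have -> : (b - A * d) * (1 - A) = A * A * d + b - A * (b + d) by ring.
  by rewrite h hp mulr1 subrr.
apply/eqP; rewrite eq_sym -subr_eq0; apply/negPn/negP => A1.
move: e1 e2 => /eqP; rewrite mulf_eq0 (negPf A1) orbF subr_eq0 => /eqP aE.
move=> /eqP; rewrite mulf_eq0 (negPf A1) orbF subr_eq0 => /eqP bE.
have : (1 + A) ^+ 2 * B <= 4 by rewrite t2; move: hs2; rewrite aE bE; nra.
move=> h; have : (1 - A) ^+ 2 <= 0.
  have A0 : 0 <= A by rewrite t1 addr_ge0 ?sqr_ge0.
  have := ler_wpM2l A0 h; rewrite mulrCA hp mulr1; lra.
by rewrite le_eqVlt ltNge sqr_ge0 orbF sqrf_eq0 (negPf A1).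
Qed.

End Scalars.

(** * Resolvents, the Koszul complex and the Taylor spectrum *)

Section Operators.
Variables (R : realType) (H : hilbert R).
Implicit Types (S T A B P U V W Z : bop H) (x y z : H) (s p l : R[i]) (u : nat -> H).
Implicit Types (f : {poly {poly R[i]}}).

Definition invertible T := exists V, V * T = 1 /\ T * V = 1.

Lemma invertibleM S T : invertible S -> invertible T -> invertible (S * T).
Proof.
move=> [V [h1 h2]] [W [h3 h4]]; exists (W * V); split.
  by rewrite mulrA -(mulrA W) h1 mulr1.
by rewrite mulrA -(mulrA S) h4 mulr1.
Qed.

Lemma invertibleZ l T : l != 0 -> invertible T -> invertible (l *: T).
Proof.
move=> l0 [V [h1 h2]]; exists (l^-1 *: V).
by split; rewrite bop_scalel bop_scaler scalerA ?mulVf ?mulfV // scale1r.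
Qed.

(** The partial sums of the geometric series, generated by [X |-> 1 + W * X]. *)
Lemma neumann_one W (q : R) : 0 <= q < 1 -> (forall x, nrm (W x) <= q * nrm x) ->
  invertible (1 - W).
Proof.
move=> /andP[q0 q1] hW.
pose X := fix X n := if n is m.+1 then 1 + W * X m else 0 : bop H.
have XS n : X n.+1 = 1 + W * X n by [].
have dX n x : nrm (X n.+1 x - X n x) <= q ^+ n * nrm x.
  elim: n x => [|n IH] x.
    by rewrite XS (_ : X 0%N = 0) // mulr0 addr0 bop1E bop0E subr0 expr0 mul1r.
  have -> : X n.+2 x - X n.+1 x = W (X n.+1 x - X n x).
    by rewrite (XS n.+1) [in X in _ - X](XS n) !bopDE !bopME opB opprD addrACA subrr add0r.
  by rewrite (le_trans (hW _)) // exprS -mulrA ler_wpM2l.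
have q1' : 1 - q != 0 by rewrite subr_eq0 eq_sym lt_eqF.
have [||L hL] := @bop_limit _ _ X (fun n => (1 - q ^+ n) / (1 - q)) ((1 - q)^-1).
- move=> n x; have -> : (1 - q ^+ n.+1) / (1 - q) - (1 - q ^+ n) / (1 - q) = q ^+ n.
    by rewrite exprS; field.
  exact: dX.
- move=> n; rewrite ler_piMl ?invr_ge0 ?subr_ge0 ?(ltW q1) // gerBl.
  by rewrite exprn_ge0.
have LE : L = 1 + W * L.
  apply: bop_ext => x; have hL' : tendsto (fun n => X n.+1 x) (L x).
    by rewrite /tendsto (cvg_shiftS (fun n => nrm (X n x - L x))); apply: hL.
  apply: tendsto_unique hL' _; rewrite bopDE bopME.
  by apply: (tendstoD (tendsto_cst _)); apply: tendsto_bop.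
have WL : GRing.comm W L.
  apply: limit_comm hL _; elim=> [|n IH]; first exact: commr0.
  by rewrite XS; apply: commrD; [apply: commr1|apply: commrM].
exists L; split; first by rewrite mulrBr mulr1 -WL {1}LE addrK.
by rewrite mulrBl mul1r {1}LE addrK.
Qed.

Lemma neumann T l (c : R) : 0 <= c < modulus l -> (forall x, nrm (T x) <= c * nrm x) ->
  invertible (T - l *: (1 : bop H)).
Proof.
move=> /andP[c0 cl] hT.
have l0 : l != 0.
  by apply: contraTneq cl => ->; rewrite /modulus normr0 -leNgt.
have ml0 : 0 < modulus l := le_lt_trans c0 cl.
have -> : T - l *: (1 : bop H) = (- l) *: (1 - l^-1 *: T).
  by rewrite scalerBr !scaleNr scalerA mulfV // scale1r opprK addrC.
apply: invertibleZ; first by rewrite oppr_eq0.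
apply: (@neumann_one _ (c / modulus l)).
  by rewrite divr_ge0 ?(ltW ml0) //= ltr_pdivrMr // mul1r.
move=> x; rewrite bopZE nrmZ -/(modulus _) modulusV mulrC mulrAC.
by rewrite ler_wpM2r ?invr_ge0 ?(ltW ml0).
Qed.

Lemma unitary_invertible U : unitary U -> invertible U.
Proof. by move=> uU; exists (adj U). Qed.

(** Inside the disc, [U - l = - U * (l adj U - 1)] and [l adj U] is a strict
    contraction. *)
Lemma unitary_resolvent U l : unitary U -> modulus l != 1 -> invertible (U - l *: (1 : bop H)).
Proof.
move=> uU; rewrite neq_lt => /orP[l1|l1]; last first.
  apply: (@neumann _ _ 1); first by rewrite ler01.
  by move=> x; rewrite mul1r unitary_nrm.
have [U1 U2] := uU.
have -> : U - l *: (1 : bop H) = (-1) *: (U * (l *: adj U - 1 *: (1 : bop H))).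
  by rewrite scale1r scaleN1r mulrBr mulr1 bop_scaler U2 opprB.
apply: invertibleZ; first by rewrite oppr_eq0 oner_neq0.
apply: invertibleM; first exact: unitary_invertible.
apply: (@neumann _ _ (modulus l)).
  by rewrite modulus_ge0 /= [modulus 1]/modulus normr1.
by move=> x; rewrite bopZE nrmZ (unitary_nrm _ (unitary_adj uU)).
Qed.

(** Multiplication by the inverse of [B - l A] is a contracting homotopy of the
    complex. *)
Lemma koszul_exact_of_invertible A B l : GRing.comm A B ->
  invertible (B - l *: A) -> koszul_exact A B.
Proof.
move=> AB [V [VG GV]].
have comV Z : GRing.comm Z A -> GRing.comm Z B -> GRing.comm Z V.
  move=> ZA ZB; have ZG : GRing.comm Z (B - l *: A) by comm.
  by rewrite /GRing.comm -[LHS]mul1r -VG mulrA -(mulrA V) -ZG mulrA -(mulrA _ _ V) GV mulr1.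
have AV : GRing.comm A V by apply: comV.
have BV : GRing.comm B V by apply: comV.
have VGx x : V (B x - l *: A x) = x.
  by have := congr1 (fun T : bop H => T x) VG; rewrite bopME bopBE bopZE.
have GVx x : B (V x) - l *: A (V x) = x.
  by have := congr1 (fun T : bop H => T x) GV; rewrite bopME bopBE bopZE.
have AVx x : A (V x) = V (A x) by rewrite -!bopME AV.
have BVx x : B (V x) = V (B x) by rewrite -!bopME BV.
have ABx x : A (B x) = B (A x) by rewrite -!bopME AB.
split.
- apply/seteqP; split=> x /=; last by move=> ->; rewrite /koszul0 !op0.
  by case=> Ax Bx; rewrite -(VGx x) Ax Bx scaler0 subr0 op0.
- apply/seteqP; split=> [_ [x _ <-]|[u1 u2]] /=; first by rewrite /koszul1 /= ABx subrr.
  rewrite /koszul1 /= => /eqP; rewrite subr_eq0 => /eqP e.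
  exists (V (u2 - l *: u1)) => //; rewrite /koszul0 AVx BVx !opB !opZ.
  by congr (_, _); [rewrite e|rewrite -e]; rewrite -opZ -opB VGx.
- apply/seteqP; split=> // y _ /=.
  exists (- V y, - (l *: V y)) => //; rewrite /koszul1 /= !opN opZ opprK addrC.
  exact: GVx.
Qed.

Lemma shift_opE T l : shift_op T l = (T - l *: (1 : bop H)) :> (H -> H).
Proof. by apply/funext => x; rewrite bopBE bopZE bop1E. Qed.

(** If the roots [z], [w] of [X^2 - s X + p] are not both unimodular, say [z]
    is not, then [(U * V - p) - z (U + V - s) = (U - z) * (V - z)] is
    invertible. *)
Lemma taylor_spectrum_unitaries U V s p : unitary U -> unitary V -> GRing.comm U V ->
  taylor_spectrum (U + V : bop H) (U * V : bop H) (s, p) -> bGamma (s, p).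
Proof.
move=> uU uV UV /= hk; apply: contrapT => nb; apply: hk.
have [z1 [z2 [sE pE]]] := sum_product_roots s p.
suff : koszul_exact (shift_op (U + V : bop H) s) (shift_op (U * V : bop H) p) by [].
rewrite !shift_opE.
have [z [hz [w [swE pwE]]]] : exists z : R[i],
    modulus z != 1 /\ exists w : R[i], s = z + w /\ p = z * w.
  have [m1|m1] := eqVneq (modulus z1) 1; last by exists z1; split => //; exists z2.
  have [m2|m2] := eqVneq (modulus z2) 1; last first.
    by exists z2; split => //; exists z1; rewrite addrC mulrC.
  by case: nb; exists (z1, z2); [split; apply/modulus_eq1|rewrite /= sE pE].
apply: (@koszul_exact_of_invertible _ _ z); first by comm.
have -> : U * V - p *: (1 : bop H) - z *: (U + V - s *: (1 : bop H)) =
    (U - z *: (1 : bop H)) * (V - z *: (1 : bop H)).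
  have -> : (U - z *: (1 : bop H)) * (V - z *: (1 : bop H)) =
      U * V + (z * z) *: (1 : bop H) - (z *: U + z *: V).
    rewrite mulrBl !mulrBr !bop_scalel !bop_scaler mulr1 !mul1r scalerA.
    by rewrite opprB addrACA -opprD.
  rewrite scalerBr scalerDr scalerA swE pwE mulrDr scalerDl opprB.
  by rewrite (addrC ((z * z) *: _)) addrA addrA subrK.
by apply: invertibleM; apply: unitary_resolvent.
Qed.

(** Take [y] to be the sum of the [4^-j u_j] with signs chosen so that each
    term does not cancel against the preceding partial sum.  The first [k + 1]
    terms then contribute at least [4^-k] to [ip y (u k)], and the remaining
    ones at most a third of that. *)
Lemma gliding_hump u : (forall k, nrm (u k) = 1) ->
  exists y, forall k, 2/3 * (1/4) ^+ k <= `|ip y (u k)|.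
Proof.
move=> u1.
pose sg (x y : H) : R := if 0 <= ip x y then 1 else -1.
pose v := fix v n := if n is m.+1 then v m + (sg (v m) (u m) * (1/4) ^+ m)%:C *: u m else 0 : H.
have vS n : v n.+1 = v n + (sg (v n) (u n) * (1/4) ^+ n)%:C *: u n by [].
have p4 n : 0 < (1/4 : R) ^+ n by rewrite exprn_gt0 //; lra.
have sg1 x y : `|sg x y| = 1 by rewrite /sg; case: ifP => _; rewrite ?normrN normr1.
have [|n|y _ hy] := @telescope_cvg _ _ v (fun n => - (4/3 * (1/4) ^+ n)) 0.
- move=> n; rewrite vS addrC addKr nrmZr normrM sg1 u1 mulr1 mul1r ger0_norm ?(ltW (p4 n)) //.
  by rewrite exprS; lra.
- by rewrite oppr_le0 mulr_ge0 ?(ltW (p4 n)) //; lra.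
exists y => k.
have h1 : (1/4) ^+ k <= `|ip (v k.+1) (u k)|.
  rewrite vS ipDl ipZl ip_nrm u1 expr1n mulr1 /sg; have := p4 k.
  set q := _ ^+ k; case: (lerP 0 (ip (v k) (u k))) => h q0; first by rewrite mul1r ger0_norm; lra.
  by rewrite mulN1r ltr0_norm; lra.
have h2 := ip_abs_le (y - v k.+1) (u k); rewrite u1 mulr1 in h2.
have h3 := hy k.+1; rewrite exprS in h3.
have -> : ip y (u k) = ip (v k.+1) (u k) + ip (y - v k.+1) (u k).
  by rewrite -ipDl addrC subrK.
have := lerB_normD (ip (v k.+1) (u k)) (ip (y - v k.+1) (u k)); lra.
Qed.

Lemma approx_eigen_ip u T l y : (forall k, nrm (u k) = 1) ->
  approx_eigen u (adj T) (Num.conj l) ->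
  exists D : R, forall k, `|ip ((T - l *: (1 : bop H)) y) (u k)| <= D * (1/8) ^+ k.
Proof.
move=> u1 [D hD]; exists (nrm y * D) => k.
have -> : ip ((T - l *: (1 : bop H)) y) (u k) = ip y (adj T (u k) - Num.conj l *: u k).
  by rewrite adjP adjB adjZ adj1 bopBE bopZE bop1E.
by rewrite (le_trans (ip_abs_le _ _)) // -mulrA ler_wpM2l ?nrm_ge0.
Qed.

(** If [y = (S - s) x2 - (P - p) x1] then [ip y (u k) = O(8^-k)], which fails
    for the vector [y] of [gliding_hump].  So the last map of the Koszul
    complex is not onto. *)
Lemma approx_eigen_taylor S P u s p : (forall k, nrm (u k) = 1) ->
  approx_eigen u (adj S) (Num.conj s) -> approx_eigen u (adj P) (Num.conj p) ->
  taylor_spectrum S P (s, p).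
Proof.
move=> u1 hS hP /= [_ _ surj].
have [y hy] := gliding_hump u1.
have [[x1 x2] _ e] : range (koszul1 (shift_op S s) (shift_op P p)) y by rewrite surj.
have [D hD] := approx_eigen_ip x2 u1 hS; have [E hE] := approx_eigen_ip x1 u1 hP.
have h : (2/3 : R) <= 0.
  apply: (@geometric_vanish _ (D + E) (1/2)); first by apply/andP; split; lra.
  move=> k; have p4 : 0 < (1/4 : R) ^+ k by rewrite exprn_gt0 //; lra.
  rewrite -(ler_pM2r p4) -[leRHS]mulrA -exprMn (_ : 1/2 * (1/4) = 1/8 :> R); last by field.
  apply: le_trans (hy k) _.
  rewrite -e /koszul1 /= !shift_opE ipBl mulrDl (le_trans (ler_normB _ _)) //.
  by rewrite lerD.
by move: h; rewrite leNgt; apply/negP/negPn; lra.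
Qed.

Lemma approx_eigen_spectrum T u l : (forall k, nrm (u k) = 1) ->
  approx_eigen u T l -> ~ invertible (T - l *: (1 : bop H)).
Proof.
move=> u1 [D hD] [V [VT _]]; have [K K0 hK] := bop_bound V.
have h : (1 : R) <= 0.
  apply: (@geometric_vanish _ (K * D) (1/8)); first by apply/andP; split; lra.
  move=> k; have e : nrm (V ((T - l *: (1 : bop H)) (u k))) = 1.
    by rewrite -bopME VT bop1E u1.
  rewrite -[leLHS]e bopBE bopZE bop1E (le_trans (hK _)) //.
  by rewrite -mulrA ler_pM2l.
by move: h; rewrite ler10.
Qed.

End Operators.

(** * The relations and the joint spectrum *)

Section Implications.
Variables (R : realType) (H : hilbert R).
Implicit Types (S T A B P U V W Z : bop H) (x y : H) (s p l : R[i]) (u : nat -> H).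
Implicit Types (f : {poly {poly R[i]}}).

Lemma approx_eigen_le u T l (m : R) : (forall k, nrm (u k) = 1) ->
  (forall k, nrm (T (u k)) <= m) -> approx_eigen u T l -> modulus l <= m.
Proof.
move=> u1 hT [D hD]; rewrite -subr_le0.
apply: (@geometric_vanish _ D (1/8)) => [|k]; first by apply/andP; split; lra.
have := nrmB (T (u k)) (T (u k) - l *: u k); rewrite opprB addrC subrK nrmZ u1 mulr1.
by rewrite -/(modulus l); have := hD k; have := hT k; lra.
Qed.

Lemma approx_eigen0 u l : (forall k, nrm (u k) = 1) -> approx_eigen u (0 : bop H) l -> l = 0.
Proof.
move=> u1 h; apply/eqP; rewrite -normr_eq0 modulusE.
rewrite (_ : modulus l = 0) //; apply/eqP; rewrite eq_le modulus_ge0 andbT.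
by apply: (approx_eigen_le u1 _ h) => k; rewrite bop0E nrm0.
Qed.

Definition joint_spectrum S P s p := exists u, [/\ forall k, nrm (u k) = 1,
  approx_eigen u S s, approx_eigen u (adj S) (Num.conj s),
  approx_eigen u P p & approx_eigen u (adj P) (Num.conj p)].

Definition commuting_normals S P := [/\ normal S, normal P, GRing.comm S P &
  GRing.comm S (adj P)].

(** A vector violating the bound would produce, by [joint_eigenvectors], a
    joint approximate eigenvalue at which the modulus of [t] exceeds [m]. *)
Lemma joint_spectrum_bound S P T (t : R[i] -> R[i] -> R[i]) (m : R) :
  commuting_normals S P ->
  GRing.comm (adj T * T) S -> GRing.comm (adj T * T) P ->
  (forall u s p, (forall k, nrm (u k) = 1) ->
    approx_eigen u S s -> approx_eigen u (adj S) (Num.conj s) ->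
    approx_eigen u P p -> approx_eigen u (adj P) (Num.conj p) ->
    approx_eigen u T (t s p)) ->
  0 <= m -> (forall s p, joint_spectrum S P s p -> modulus (t s p) <= m) ->
  forall x, nrm (T x) <= m * nrm x.
Proof.
move=> [nS nP SP SP'] TS TP hT m0 hm x; rewrite leNgt; apply/negP => mx.
have [u [s [p [r [mr u1 ru [hS hS'] [hP hP']]]]]] :=
  joint_eigenvectors nS nP SP SP' TS TP m0 mx.
have := approx_eigen_bound u1 ru (hT _ _ _ u1 hS hS' hP hP').
rewrite -/(modulus _) => h.
have := hm s p; rewrite leNgt (lt_le_trans mr h) => /(_ _)/negP; apply => //.
by exists u.
Qed.

Definition gamma_relations S P := [/\ unitary P, GRing.comm S P, S = adj S * P &
  forall x, nrm (S x) <= 2 * nrm x].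

(** Both [S * adj S] and [adj S * S] equal [adj S * adj S * P]. *)
Lemma relation_normal S P : unitary P -> GRing.comm S P -> S = adj S * P ->
  commuting_normals S P.
Proof.
move=> uP SP SE; have SP' := unitary_comm uP SP.
have S'P : GRing.comm (adj S) P by rewrite -(adjK P); apply: comm_adj.
split=> //; last by case: uP => h1 h2; rewrite /normal /GRing.comm h1 h2.
have e : adj S * S = adj S * (adj S * P) by rewrite -SE.
by rewrite /normal /GRing.comm e {1}SE -mulrA -S'P.
Qed.

(** The relations between the operators pass to their approximate eigenvalues. *)
Lemma joint_spectrum_bGamma S P s p : gamma_relations S P ->
  joint_spectrum S P s p -> bGamma (s, p).
Proof.
move=> [[P1 _] _ SE S2] [u [u1 hS hS' hP hP']].
apply: conditions_bGamma.
- have := approx_eigenB (approx_eigenM hP' hP) (approx_eigen_id u).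
  rewrite P1 subrr => /(approx_eigen0 u1)/subr0_eq e.
  apply/eqP; rewrite -(@eqrXn2 _ 2) ?modulus_ge0 // expr1n; apply/eqP/complexI.
  by rewrite rmorphXn /= -modulusE normCK mulrC.
- have := approx_eigenB hS (approx_eigenM hS' hP).
  by rewrite -SE subrr => /(approx_eigen0 u1)/subr0_eq.
- by apply: (approx_eigen_le u1 _ hS) => k; have := S2 (u k); rewrite u1 mulr1.
Qed.

Lemma commuting_normals_adj S P : commuting_normals S P ->
  [/\ GRing.comm P (adj S), GRing.comm (adj S) (adj P), GRing.comm S (adj S) &
      GRing.comm P (adj P)].
Proof.
move=> [nS nP SP SP']; split => //; last exact: comm_adj.
by rewrite -(adjK P); apply/comm_adj/commr_sym.
Qed.

(** Each relation says that some operator, built from [S], [P] and their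
    adjoints, vanishes or has norm at most 2; [joint_spectrum_bound] reduces it
    to the corresponding property of the points of [bGamma]. *)
Lemma taylor_relations S P : normal S -> normal P -> GRing.comm S P ->
  (forall s p, taylor_spectrum S P (s, p) -> bGamma (s, p)) -> gamma_relations S P.
Proof.
move=> nS nP SP hb; have SP' := fuglede nP SP.
have cn : commuting_normals S P by [].
have [PS' SP'' nS' nP'] := commuting_normals_adj cn.
have jb s p : joint_spectrum S P s p -> bGamma (s, p).
  by move=> [u [u1 _ hS' _ hP']]; apply: hb; apply: approx_eigen_taylor hP'.
(* The first two relations are bounds by 0. *)
have zero T : (forall x, nrm (T x) <= 0 * nrm x) -> T = 0.
  move=> h; apply: bop_ext => x; apply/nrm_eq0/eqP.
  by rewrite eq_le nrm_ge0 andbT -(mul0r (nrm x)).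
have m0 : modulus (0 : R[i]) <= 0 by rewrite /modulus normr0.
have P1 : adj P * P = 1.
  apply/subr0_eq/zero; apply: (@joint_spectrum_bound S P _ (fun s p => Num.conj p * p - 1) 0) => //.
  - by rewrite adjB adjM adjK adj1; comm.
  - by rewrite adjB adjM adjK adj1; comm.
  - move=> u s p u1 _ _ hP hP'; apply: approx_eigenB; last exact: approx_eigen_id.
    exact: approx_eigenM.
  - move=> s p /jb/bGamma_conditions[hp _ _].
    by rewrite mulrC -normCK modulusE hp expr1n subrr.
split=> //.
- by split=> //; rewrite nP'.
- apply/subr0_eq/zero; apply: (@joint_spectrum_bound S P _ (fun s p => s - Num.conj s * p) 0) => //.
  - by rewrite adjB adjM adjK; comm.
  - by rewrite adjB adjM adjK; comm.
  - by move=> u s p u1 hS hS' hP _; apply: approx_eigenB => //; apply: approx_eigenM.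
  - by move=> s p /jb/bGamma_conditions[_ <- _]; rewrite subrr.
- apply: (@joint_spectrum_bound S P _ (fun s p => s)) => //; try comm.
  by move=> s p /jb/bGamma_conditions[].
Qed.

Lemma spectral_radius_relations S P : unitary P -> GRing.comm S P -> S = adj S * P ->
  (forall l, ~ invertible (S - l *: (1 : bop H)) -> modulus l <= 2) -> gamma_relations S P.
Proof.
move=> uP SP SE hs; split => //.
have cn := relation_normal uP SP SE.
have [PS' SP'' nS' nP'] := commuting_normals_adj cn.
apply: (@joint_spectrum_bound S P _ (fun s p => s)) => //; try comm.
by move=> s p [u [u1 hS _ _ _]]; apply/hs/(approx_eigen_spectrum u1 hS).
Qed.

(** [poly2_op] as an element of the ring of bounded operators. *)
Definition pbop f S P : bop H :=
  \sum_(i < size f) \sum_(j < size f`_i) f`_i`_j *: (S ^+ i * P ^+ j).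

Lemma bop_sumE n (F : 'I_n -> bop H) x : (\sum_(i < n) F i) x = \sum_(i < n) F i x.
Proof.
elim: n F => [|n IH] F; first by rewrite !big_ord0.
by rewrite !big_ord_recr bopDE IH.
Qed.

Lemma iter_bop S n x : iter n S x = (S ^+ n) x.
Proof. by elim: n => [|n IH] //=; rewrite IH exprS. Qed.

Lemma poly2_opE f S P : poly2_op f S P = pbop f S P :> (H -> H).
Proof.
apply/funext => x; rewrite /poly2_op /pbop bop_sumE; apply: eq_bigr => i _.
rewrite bop_sumE; apply: eq_bigr => j _.
by rewrite bopZE bopME !iter_bop.
Qed.

Lemma poly2_eval_sum f s p : poly2_eval f (s, p) =
  \sum_(i < size f) \sum_(j < size f`_i) f`_i`_j * (s ^+ i * p ^+ j).
Proof.
rewrite /poly2_eval /= (horner_coef f) horner_sum; apply: eq_bigr => i _.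
rewrite hornerM horner_exp hornerC horner_coef mulr_suml.
by apply: eq_bigr => j _; rewrite -mulrA (mulrC (s ^+ i)).
Qed.

Lemma approx_eigen_sum u n (F : 'I_n -> bop H) (a : 'I_n -> R[i]) :
  (forall i, approx_eigen u (F i) (a i)) ->
  approx_eigen u (\sum_(i < n) F i) (\sum_(i < n) a i).
Proof.
elim: n F a => [|n IH] F a h.
  by exists 0 => k; rewrite !big_ord0 bop0E scale0r subrr nrm0 mul0r.
by rewrite !big_ord_recr; apply: approx_eigenD => //; apply: IH.
Qed.

Lemma approx_eigenX u T l n : approx_eigen u T l -> approx_eigen u (T ^+ n) (l ^+ n).
Proof.
move=> h; elim: n => [|n IH]; first exact: approx_eigen_id.
by rewrite !exprS; apply: approx_eigenM.
Qed.

Lemma approx_eigen_pbop u f S P s p : approx_eigen u S s -> approx_eigen u P p ->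
  approx_eigen u (pbop f S P) (poly2_eval f (s, p)).
Proof.
move=> hS hP; rewrite poly2_eval_sum; apply: approx_eigen_sum => i.
apply: approx_eigen_sum => j; apply: approx_eigenZ.
by apply: approx_eigenM; apply: approx_eigenX.
Qed.

Lemma comm_sum Z n (F : 'I_n -> bop H) : (forall i, GRing.comm Z (F i)) ->
  GRing.comm Z (\sum_(i < n) F i).
Proof.
elim: n F => [|n IH] F h; first by rewrite big_ord0; apply: commr0.
by rewrite big_ord_recr; apply: commrD => //; apply: IH.
Qed.

Lemma comm_pbop Z f S P : GRing.comm Z S -> GRing.comm Z P -> GRing.comm Z (pbop f S P).
Proof.
move=> ZS ZP; apply: comm_sum => i; apply: comm_sum => j; apply: commZ.
by apply: commrM; apply: commrX.
Qed.

(** [joint_spectrum_bound] applied to the operator polynomial itself. *)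
Lemma von_neumann S P f (m : R) : gamma_relations S P -> 0 <= m ->
  (forall s p, bGamma (s, p) -> modulus (poly2_eval f (s, p)) <= m) ->
  forall x, nrm (pbop f S P x) <= m * nrm x.
Proof.
move=> rel m0 hm; have [uP SP SE S2] := rel.
have cn := relation_normal uP SP SE.
have [PS' SP'' nS' nP'] := commuting_normals_adj cn.
have [_ _ _ SP'] := cn.
have adjc Z : GRing.comm Z (adj S) -> GRing.comm Z (adj P) -> GRing.comm Z (adj (pbop f S P)).
  move=> h1 h2; rewrite -(adjK Z); apply: comm_adj; apply: comm_pbop.
    by rewrite -(adjK S); apply: comm_adj.
  by rewrite -(adjK P); apply: comm_adj.
apply: (@joint_spectrum_bound S P _ (fun s p => poly2_eval f (s, p))) => //.
- apply/commr_sym/commrM; first by apply: adjc => //.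
  by apply: comm_pbop.
- apply/commr_sym/commrM; first by apply: adjc.
  by apply: comm_pbop => //; apply: commr_sym.
- by move=> u s p u1 hS _ hP _; apply: approx_eigen_pbop.
- by move=> s p /(joint_spectrum_bGamma rel); apply: hm.
Qed.

End Implications.

(** * Gamma-contractions with unitary second component *)

Section GammaContraction.
Variables (R : realType) (H : hilbert R).
Implicit Types (S T A B P U V W Z : bop H) (x y : H) (s p l w : R[i]).
Implicit Types (f : {poly {poly R[i]}}).

(** Write [p = z1 z2], [s = z1 + z2], [t1], [t2] for the squared moduli of
    [z1], [z2], and [g] for the bracket.  The cross term [2 e Re (conj p g)]
    equals [- 2 e Re (w (z1 t2 (1 - t1) + z2 t1 (1 - t2)))], which vanishes on
    the torus and for [e <= 1/4] is at most the deficit [1 - t1 t2].  Only [e^2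
    |g|^2] remains, and [|g| <= 4]. *)
Lemma gamma_scalar_bound (z1 z2 w : R[i]) (e : R) :
  modulus z1 <= 1 -> modulus z2 <= 1 -> modulus w = 1 -> 0 <= e <= 1/4 ->
  modulus (z1 * z2 + e%:C * (w * (z1 + z2) * (z1 * z2) - Num.conj w * (z1 + z2))) ^+ 2
    <= 1 + 16 * e ^+ 2.
Proof.
move=> m1 m2 mw /andP[e0 e4].
set p := z1 * z2; set g := _ - _.
pose t1 := modulus z1 ^+ 2; pose t2 := modulus z2 ^+ 2.
have p1 := modulus_ge0 z1; have p2 := modulus_ge0 z2.
have t10 : 0 <= t1 <= 1 by rewrite sqr_ge0 expr_le1.
have t20 : 0 <= t2 <= 1 by rewrite sqr_ge0 expr_le1.
have mN z : modulus (- z) = modulus z by rewrite /modulus normrN.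
have mJ z : modulus (Num.conj z) = modulus z by rewrite /modulus norm_conjC.
have mr (r : R) : modulus r%:C = `|r|.
  by rewrite /modulus normc_def /= expr0n addr0 sqrtr_sqr.
have g4 : modulus g <= 4.
  have hs : modulus (z1 + z2) <= 2 by rewrite (le_trans (modulusD _ _)) //; lra.
  have hp : modulus p <= 1 by rewrite modulusM mulr_ile1.
  have := modulusD (w * (z1 + z2) * p) (- (Num.conj w * (z1 + z2))).
  rewrite mN !modulusM mJ mw !mul1r -/g.
  have : modulus (z1 + z2) * modulus p <= 2 * 1 by rewrite ler_pM ?modulus_ge0.
  rewrite modulusM; lra.
pose c1 : R := t2 * (1 - t1); pose c2 : R := t1 * (1 - t2).
have expand : modulus (p + e%:C * g) ^+ 2 =
    t1 * t2 + 2 * e * complex.Re (- (w * (z1 * c1%:C + z2 * c2%:C))) + e ^+ 2 * modulus g ^+ 2.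
  rewrite /c1 /c2 /t1 /t2 /g /p !modulus_sq.
  by case: (z1) (z2) (w) => [a b] [c d] [h k] /=; ring.
have /andP[t1n t1l] := t10; have /andP[t2n t2l] := t20.
have c10 : 0 <= c1 by rewrite mulr_ge0 // subr_ge0.
have c20 : 0 <= c2 by rewrite mulr_ge0 // subr_ge0.
have re : complex.Re (- (w * (z1 * c1%:C + z2 * c2%:C))) <= (1 - t1) + (1 - t2).
  rewrite (le_trans (Re_le_modulus _)) // mN modulusM mw mul1r.
  rewrite (le_trans (modulusD _ _)) // !modulusM !mr.
  rewrite !ger0_norm // lerD //.
    by rewrite (le_trans (ler_piMl c10 m1)) // ler_piMl // subr_ge0.
  by rewrite (le_trans (ler_piMl c20 m2)) // ler_piMl // subr_ge0.
have g16 : modulus g ^+ 2 <= 16 by have := modulus_ge0 g; nra.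
rewrite expand; clearbody t1 t2 c1 c2 g.
set q := complex.Re _ in re *; clearbody q.
have h1 : 2 * e * q <= 2 * e * ((1 - t1) + (1 - t2)) by rewrite ler_wpM2l //; lra.
have h2 : e ^+ 2 * modulus g ^+ 2 <= e ^+ 2 * 16 by rewrite ler_wpM2l ?sqr_ge0.
have h3 : 2 * e * ((1 - t1) + (1 - t2)) <= 1/2 * ((1 - t1) + (1 - t2)).
  by rewrite ler_wpM2r //; lra.
nra.
Qed.

Lemma pbop_small f S P : (size f <= 2)%N ->
  (forall i, (size (f`_i)%R <= 2)%N) ->
  pbop f S P = f`_0`_0 *: (1 : bop H) + f`_0`_1 *: P + (f`_1`_0 *: S + f`_1`_1 *: (S * P)).
Proof.
move=> sf sfi; rewrite /pbop.
rewrite (big_ord_widen 2 (fun i => \sum_(j < size f`_i) f`_i`_j *: (S ^+ i * P ^+ j))) //.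
rewrite big_mkcond /=.
rewrite [LHS](_ : _ = \sum_(i < 2) \sum_(j < 2) f`_i`_j *: (S ^+ i * P ^+ j)).
  rewrite !big_ord_recl !big_ord0 /= !addr0 /bump /= !addn0.
  by rewrite !expr0 !expr1 !mulr1 !mul1r.
apply: eq_bigr => i _; case: ltnP => [_|h].
  rewrite (big_ord_widen 2 (fun j => f`_i`_j *: (S ^+ i * P ^+ j))) // big_mkcond /=.
  by apply: eq_bigr => j _; case: ltnP => // h; rewrite nth_default // scale0r.
rewrite big1 // => j _.
by rewrite (nth_default 0 h) coef0 scale0r.
Qed.

(** The inequality defining Gamma-contractions, with any upper bound [m]
    instead of the extended real supremum. *)
Definition gamma_bounded S P := forall f (m : R), 0 <= m ->
  (forall s p, Gamma (s, p) -> modulus (poly2_eval f (s, p)) <= m) ->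
  forall x, nrm (pbop f S P x) <= m * nrm x.

Lemma gamma_bounded_norm S P : gamma_bounded S P -> forall x, nrm (S x) <= 2 * nrm x.
Proof.
move=> h x; pose f : {poly {poly R[i]}} := 'X.
have f0 : f`_0 = 0 by rewrite /f coefX.
have f1 : f`_1 = 1 by rewrite /f coefX.
have sfi i : (size (f`_i)%R <= 2)%N.
  by rewrite /f coefX; case: (i == 1)%N; rewrite ?size_poly1 ?size_poly0.
have f00 : f`_0`_0 = 0 by rewrite f0 coef0.
have f01 : f`_0`_1 = 0 by rewrite f0 coef0.
have f10 : f`_1`_0 = 1 by rewrite f1 coef1.
have f11 : f`_1`_1 = 0 by rewrite f1 coef1.
have fE : pbop f S P = S.
  rewrite pbop_small ?size_polyX // f00 f01 f10 f11.
  by rewrite !scale0r scale1r !add0r addr0.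
rewrite -[in leLHS]fE; apply: h => //.
move=> s p [[z1 z2] /= [h1 h2] [<- _]].
rewrite /poly2_eval /= /f hornerX hornerC (le_trans (modulusD _ _)) //.
by rewrite modulusE lecR in h1; rewrite modulusE lecR in h2; lra.
Qed.

(** Polarisation: the real form and its rotation by [i] together determine the
    complex quadratic form. *)
Lemma quadratic_form_zero T : (forall x, ip (T x) x = 0) ->
  (forall x, ip ('i%C *: T x) x = 0) -> T = 0.
Proof.
move=> h1 h2; apply: bop_ext => x; rewrite bop0E.
have a y z : ip (T y) z + ip (T z) y = 0.
  by have := h1 (y + z); rewrite opD ipDl !ipDr !h1 add0r addr0.
have b y z : ip ('i%C *: T y) z + ip ('i%C *: T z) y = 0.
  by have := h2 (y + z); rewrite opD scalerDr ipDl !ipDr !h2 add0r addr0.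
have c y z : ip ('i%C *: T y) z = ip ('i%C *: T z) y.
  have := a ('i%C *: y) z; rewrite opZ [ip (T z) _]ipC [ip ('i%C *: y) _]ip_scale.
  rewrite (_ : Num.conj 'i%C = - 'i%C); last first.
    by apply/eqP; rewrite eq_complex /= oppr0 !eqxx.
  by rewrite scaleNr ipNr (ipC y) => /subr0_eq.
apply: ip_ext => y; rewrite ip0l.
have d z : ip ('i%C *: T x) z = 0 by have := b x z; rewrite -c; lra.
have := d ('i%C *: y); rewrite ip_scale scalerA.
rewrite (_ : Num.conj 'i%C * 'i%C = 1) ?scale1r //.
by apply/eqP; rewrite eq_complex /=; apply/andP; split; apply/eqP; ring.
Qed.

(** Apply the inequality to [P + e G], where [G = w (S * P) - conj w S], and
    expand: since [P] is isometric, the first-order term gives [ip (P y) (G y)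
    <= 0]. The left-hand side is [ip (w (S - adj S * P) y) y], and [w] is an
    arbitrary unimodular constant. *)
Lemma gamma_bounded_relations S P : gamma_bounded S P -> unitary P -> GRing.comm S P ->
  gamma_relations S P.
Proof.
move=> hb uP SP; split => //; last exact: (gamma_bounded_norm hb).
have [P1 P2] := uP.
pose D := S - adj S * P.
have key w y : modulus w = 1 -> ip (w *: D y) y <= 0.
  move=> mw.
  pose G : bop H := w *: (S * P) - Num.conj w *: S.
  have GE : ip (P y) (G y) = ip (w *: D y) y.
    have e1 : ip (P y) (w *: S (P y)) = ip y (w *: S y).
      by rewrite -[S (P y)]bopME SP bopME -(opZ P) adjP -bopME P1 bop1E.
    have e2 : ip (P y) (Num.conj w *: S y) = ip y (w *: adj S (P y)).
      by rewrite ipC ip_scale conjCK adjP opZ.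
    rewrite /G bopBE !bopZE bopME ipBr e1 e2 -ipBr -scalerBr.
    by rewrite ipC /D bopBE bopME.
  rewrite -GE; apply: (@geometric_vanish _ (2 * nrm y ^+ 2) (1/2)).
    by apply/andP; split; lra.
  move=> n; pose e : R := 1/4 * (1/2) ^+ n.
  have e0 : 0 < e by rewrite mulr_gt0 ?exprn_gt0 //; lra.
  have e4 : e <= 1/4.
    by rewrite ler_piMr ?exprn_ile1 //; lra.
  pose f : {poly {poly R[i]}} :=
    ('X)%:P + ((e%:C * w) *: 'X - (e%:C * Num.conj w)%:P)%:P * 'X.
  have f0 : f`_0 = 'X by rewrite /f coefD coefC coefMX /= addr0.
  have f1 : f`_1 = (e%:C * w) *: 'X - (e%:C * Num.conj w)%:P.
    by rewrite /f coefD coefC coefMX /= add0r coefC.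
  have f2 i : (1 < i)%N -> f`_i = 0.
    by case: i => [|[|i]] // _; rewrite /f coefD coefC coefMX /= add0r coefC.
  have sf : (size f <= 2)%N by apply/leq_sizeP => j /f2.
  have sfi i : (size (f`_i)%R <= 2)%N.
    case: i => [|[|i]]; rewrite ?f0 ?f1 ?f2 ?size_polyX ?size_poly0 //.
    apply/leq_sizeP => -[|[|j]] // _.
    by rewrite coefB coefZ coefX coefC mulr0 subr0.
  have fE : pbop f S P = P + e%:C *: G.
    rewrite pbop_small // f0 f1 !coefX !coefB !coefZ !coefX !coefC /=.
    rewrite scale0r add0r scale1r mulr0 sub0r mulr1 subr0 /G scalerBr !scalerA scaleNr.
    by rewrite [X in P + X]addrC.
  have := hb f (Num.sqrt (1 + 16 * e ^+ 2)) (sqrtr_ge0 _).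
  rewrite fE => /(_ _ y) hn.
  have {}hn : nrm ((P + e%:C *: G) y) <= Num.sqrt (1 + 16 * e ^+ 2) * nrm y.
    apply: hn => s p [[z1 z2] /= [h1 h2] [<- <-]].
    rewrite modulusE lecR in h1; rewrite modulusE lecR in h2.
    rewrite -ler_sqr ?nnegrE ?sqrtr_ge0 ?modulus_ge0 // sqr_sqrtr; last first.
      by rewrite addr_ge0 // mulr_ge0 ?sqr_ge0.
    have -> : poly2_eval f (z1 + z2, z1 * z2) =
        z1 * z2 + e%:C * (w * (z1 + z2) * (z1 * z2) - Num.conj w * (z1 + z2)).
      rewrite /poly2_eval /= /f hornerD hornerM !hornerC hornerX.
      rewrite hornerD hornerM hornerD hornerN hornerZ !hornerX !hornerC.
      by ring.
    apply: gamma_scalar_bound => //.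
    by rewrite (ltW e0).
  have s0 : 0 <= 1 + 16 * e ^+ 2 by rewrite addr_ge0 // mulr_ge0 ?sqr_ge0.
  move: hn; rewrite nrm_le_sqr ?mulr_ge0 ?sqrtr_ge0 ?nrm_ge0 // exprMn sqr_sqrtr //.
  rewrite bopDE bopZE nrmD_sqr ipZr (unitary_nrm _ uP).
  have := sqr_ge0 (nrm (e%:C *: G y)) => h1 h2.
  have h3 : e * ip (P y) (G y) <= e * (8 * e * nrm y ^+ 2) by nra.
  rewrite ler_pM2l // in h3; apply: le_trans h3 _.
  by rewrite /e; lra.
have z w y : modulus w = 1 -> ip (w *: D y) y = 0.
  move=> mw; apply/eqP; rewrite eq_le key //=.
  have := key (- w) y; rewrite scaleNr ipNl oppr_le0; apply.
  by rewrite /modulus normrN.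
have m1 : modulus (1 : R[i]) = 1 by rewrite /modulus normr1.
have mi : modulus ('i%C : R[i]) = 1.
  by rewrite /modulus normc_def /= expr0n expr1n add0r sqrtr1.
apply/subr0_eq; apply: quadratic_form_zero => y; last exact: z.
by have := z _ y m1; rewrite scale1r.
Qed.

End GammaContraction.

(** * Bounded operators as linear maps *)

Section Translation.
Variables (R : realType) (H : hilbert R).
Implicit Types (S T A B P U V W Z : bop H) (x y : H) (s p l w : R[i]).
Implicit Types (f : {poly {poly R[i]}}).

Lemma bounded_opP (T : {linear H -> H}) : bounded_op T <-> bounded_linear T.
Proof.
rewrite /bounded_op linear_boundedP; split.
  move=> /pinfty_ex_gt0[r r0 h]; split; first exact: linearP.
  exists (complex.Re r) => x; rewrite -lecR rmorphM /= (RRe_real (gtr0_real r0)).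
  by rewrite -!normE.
move=> [_ [C hC]]; near=> r => x.
have Cr : C%:C <= r by near: r; apply: nbhs_pinfty_ge; rewrite complex_real.
by rewrite (le_trans _ (ler_wpM2r (normr_ge0 x) Cr)) // !normE -rmorphM lecR.
Unshelve. all: by end_near. Qed.

Lemma bop_bounded_op T : bounded_op (T : {linear H -> H}).
Proof. by apply/bounded_opP; apply: bopP. Qed.

(** The chosen vector exists by [adj_exists] and is unique since the inner
    product is definite. *)
Lemma adjoint_bop T : adjoint hdot T = adj T.
Proof.
apply/funext => y; rewrite /adjoint.
have h : [set z | forall x, hdot (T x) y = hdot x z] (adj T y).
  by move=> x; apply: bop_dotE.
case: xgetP => [z _ hz|/(_ _ h)//].
by apply: ip_ext => x; rewrite ipC [RHS]ipC /ip -hz bop_dotE.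
Qed.

Lemma bop_eq S T : (S =1 T) <-> S = T.
Proof. by split=> [|-> //]; apply: bop_ext. Qed.

Lemma commute_opP S T : commute_op S T <-> GRing.comm S T.
Proof. exact: (bop_eq (S * T) (T * S)). Qed.

Lemma unitary_opP U : unitary_op hdot (U : {linear H -> H}) <-> unitary U.
Proof.
rewrite /unitary_op /= adjoint_bop; split=> [[_ h1 h2]|[h1 h2]].
  by split; apply: bop_ext => x; [apply: h1|apply: h2].
split; first exact: bop_bounded_op.
  by move=> x; rewrite /= -bopME h1.
by move=> x; rewrite /= -bopME h2.
Qed.

Lemma normal_opP T : normal_op hdot (T : {linear H -> H}) <-> normal T.
Proof.
rewrite /normal_op /= adjoint_bop; split=> [[_ h]|h].
  by apply/esym; apply: bop_ext => x; apply: h.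
split; first exact: bop_bounded_op.
by move=> x; rewrite /= -!bopME h.
Qed.

Lemma spectrumP T l : spectrum T l <-> ~ invertible (T - l *: (1 : bop H)).
Proof.
rewrite /spectrum /= shift_opE; split=> h [V].
  move=> [h1 h2]; apply: h; exists (V : {linear H -> H}); first exact: bop_bounded_op.
  split=> x; first exact: (congr1 (fun A : bop H => A x) h1).
  exact: (congr1 (fun A : bop H => A x) h2).
move=> bV [h1 h2]; apply: h; exists (mkbop ((bounded_opP V).1 bV)).
by split; apply: bop_ext => x; [apply: h1|apply: h2].
Qed.

Lemma Gamma_unitary_relations S P :
  Gamma_unitary hdot (S : {linear H -> H}) (P : {linear H -> H}) -> gamma_relations S P.
Proof.
move=> [/normal_opP nS /normal_opP nP /commute_opP SP h].
by apply: taylor_relations => // s p; apply: h.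
Qed.

Lemma spectral_radius_le T (m : R) :
  (spectral_radius T <= m%:E)%E <->
  (forall l, ~ invertible (T - l *: (1 : bop H)) -> modulus l <= m).
Proof.
split=> h; last first.
  apply: ge_ereal_sup => _ [l /spectrumP hl <-].
  by rewrite lee_fin; apply: h.
move=> l /spectrumP hl; rewrite -lee_fin; apply: le_trans h.
by apply: ereal_sup_ubound; exists l.
Qed.

Lemma sum_relations U V : unitary U -> unitary V -> GRing.comm U V ->
  gamma_relations (U + V) (U * V).
Proof.
move=> uU uV UV; have [[U1 U2] [V1 V2]] := (uU, uV).
split.
- exact: unitaryM.
- by comm.
- by rewrite adjD mulrDl mulrA U1 mul1r UV mulrA V1 mul1r addrC.
- move=> x; have := nrmD (U x) (V x); rewrite (unitary_nrm x uU) (unitary_nrm x uV) bopDE; lra.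
Qed.

Lemma relations_summand S P : gamma_relations S P ->
  exists U, [/\ unitary U, GRing.comm U P & S = U + adj U * P].
Proof. by move=> [uP SP SE S2]; apply: unitary_summand. Qed.

(** The supremum over [Gamma] is nonnegative, as [Gamma] is nonempty; if it is
    infinite there is nothing to prove. *)
Lemma gamma_contractionP S P : Gamma_contraction (S : {linear H -> H}) (P : {linear H -> H}) <->
  GRing.comm S P /\ gamma_bounded S P.
Proof.
split.
  move=> [_ _ /commute_opP SP h]; split => // f m m0 hm x.
  have [->|x0] := eqVneq x 0; first by rewrite op0 nrm0 mulr0.
  have n0 : 0 < nrm x.
    by rewrite lt_neqAle nrm_ge0 andbT eq_sym; apply: contra_neq x0 => /nrm_eq0.
  have hn : (opnorm (poly2_op f S P) <= m%:E)%E.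
    apply: le_trans (h f) _; apply: ge_ereal_sup => _ [[s p] G <-].
    by rewrite lee_fin; apply: hm.
  have := le_trans _ hn; rewrite poly2_opE => h1.
  have : (((nrm (pbop f S P ((nrm x)^-1%:C *: x))))%:E <= m%:E)%E.
    apply: h1; apply: ereal_sup_ubound.
    exists ((nrm x)^-1%:C *: x) => //=.
    rewrite normE nrmZr normfV ger0_norm ?nrm_ge0 // mulVf ?gt_eqF //.
  rewrite lee_fin opZ nrmZr normfV ger0_norm ?nrm_ge0 //.
  by rewrite mulrC ler_pdivrMr.
move=> [SP hb]; split; [exact: bop_bounded_op|exact: bop_bounded_op|exact/commute_opP|].
move=> f; rewrite poly2_opE; apply: ge_ereal_sup => _ [x /= x1 <-].
set M := ereal_sup _.
have ubM s p : Gamma (s, p) -> ((modulus (poly2_eval f (s, p)))%:E <= M)%E.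
  by move=> G; apply: ereal_sup_ubound; exists (s, p).
have G0 : @Gamma R (0, 0).
  by exists (0, 0); rewrite /= ?normr0 ?ler01 // addr0 mulr0.
case: M ubM => [m ubM|_|/(_ _ _ G0)//]; last exact: leey.
have m0 : 0 <= m by have := ubM _ _ G0; rewrite lee_fin; apply: le_trans; apply: modulus_ge0.
have hm s p : Gamma (s, p) -> modulus (poly2_eval f (s, p)) <= m.
  by move=> /ubM; rewrite lee_fin.
rewrite lee_fin (le_trans (hb f m m0 hm x)) //.
by rewrite ler_piMr // -lecR -normE.
Qed.

Lemma relations_gamma_bounded S P : gamma_relations S P -> gamma_bounded S P.
Proof.
move=> rel f m m0 hm; apply: von_neumann => // s p [z [h1 h2] e].
by apply: hm; exists z => //=; rewrite h1 h2.
Qed.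

Lemma summand_Gamma_unitary S P U : unitary P -> unitary U -> GRing.comm U P ->
  S = U + adj U * P -> Gamma_unitary hdot (S : {linear H -> H}) (P : {linear H -> H}).
Proof.
move=> uP uU UP SE; have [U1 U2] := uU; have [P1 P2] := uP.
have PU : GRing.comm P (adj U) by apply: unitary_comm => //; apply: commr_sym.
have UU : GRing.comm U (adj U) by rewrite /GRing.comm U1 U2.
have uV : unitary (adj U * P) by apply: unitaryM => //; apply: unitary_adj.
have UV : GRing.comm U (adj U * P) by comm.
have PE : P = U * (adj U * P) by rewrite mulrA U2 mul1r.
have rel := sum_relations uU uV UV; rewrite -SE -PE in rel.
have [_ SP SE' _] := rel.
have [nS nP _ _] := relation_normal uP SP SE'.
split; [exact/normal_opP|exact/normal_opP|exact/commute_opP|].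
move=> [s p]; have := @taylor_spectrum_unitaries _ _ _ _ s p uU uV UV.
by rewrite -SE -PE.
Qed.

End Translation.

Theorem theorem2p5 (R : realType) (H : completeNormedModType R[i])
    (dot : {dot H for Num.conj}) (dotH : induces_norm dot)
    (sepH : separable H) (S P : {linear H -> H})
    (bS : bounded_op S) (bP : bounded_op P) (cSP : commute_op S P) :
  [<->
    Gamma_unitary dot S P;
    exists U1 U2 : {linear H -> H},
      [/\ unitary_op dot U1, unitary_op dot U2, commute_op U1 U2,
          S =1 (fun x => U1 x + U2 x) & P =1 U1 \o U2];
    [/\ unitary_op dot P, S =1 adjoint dot S \o P &
        (spectral_radius S <= 2%:E)%E];
    Gamma_contraction S P /\ unitary_op dot P;
    unitary_op dot P /\
      exists U : {linear H -> H},
        [/\ unitary_op dot U, commute_op U P &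
            S =1 (fun x => U x + adjoint dot U (P x))]].
Proof.
pose HH := Hilbert dotH.
pose S' : bop HH := mkbop ((@bounded_opP R HH S).1 bS).
pose P' : bop HH := mkbop ((@bounded_opP R HH P).1 bP).
have SP : GRing.comm S' P' := (commute_opP S' P').1 cSP.
have uPE : unitary_op dot P <-> unitary P' := unitary_opP P'.
have aSE : adjoint dot S = adj S' := adjoint_bop S'.
tfae.
- move=> h; have rel : gamma_relations S' P' := @Gamma_unitary_relations R HH S' P' h.
  have [U [uU UP SE]] := relations_summand rel.
  have [uP _ _ _] := rel; have [U1 U2] := uU.
  have PU : GRing.comm P' (adj U) by apply: unitary_comm => //; apply: commr_sym.
  have UU : GRing.comm U (adj U) by rewrite /GRing.comm U1 U2.
  exists (U : {linear HH -> HH}), (adj U * P' : bop HH); split.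
  + exact: ((unitary_opP U).2 uU).
  + by apply: (unitary_opP (adj U * P')).2; apply: unitaryM => //; apply: unitary_adj.
  + by apply: (commute_opP U (adj U * P')).2; comm.
  + exact: ((bop_eq S' (U + adj U * P')).2 SE).
  + by apply: ((bop_eq P' (U * (adj U * P'))).2); rewrite mulrA U2 mul1r.
- move=> [V1 [V2 [uV1 uV2 cV SE PE]]].
  pose U1 : bop HH := mkbop ((@bounded_opP R HH V1).1 (let: And3 b _ _ := uV1 in b)).
  pose U2 : bop HH := mkbop ((@bounded_opP R HH V2).1 (let: And3 b _ _ := uV2 in b)).
  have uU1 : unitary U1 := (unitary_opP U1).1 uV1.
  have uU2 : unitary U2 := (unitary_opP U2).1 uV2.
  have cU : GRing.comm U1 U2 := (commute_opP U1 U2).1 cV.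
  have := sum_relations uU1 uU2 cU.
  have -> : U1 + U2 = S' by apply/esym; apply: ((bop_eq S' (U1 + U2)).1 SE).
  have -> : U1 * U2 = P' by apply/esym; apply: ((bop_eq P' (U1 * U2)).1 PE).
  move=> [uP _ rel S2]; split; first exact/uPE.
    by rewrite aSE; apply: ((bop_eq S' (adj S' * P')).2 rel).
  apply/(spectral_radius_le S') => l hl; rewrite leNgt; apply/negP => l2.
  by apply: hl; apply: (@neumann _ _ S' l 2); rewrite ?l2 ?ler0n.
- move=> [/uPE uP SE hs]; split; last exact/uPE.
  have rel : gamma_relations S' P'.
    apply: spectral_radius_relations => //; last exact/spectral_radius_le.
    by rewrite aSE in SE; apply: ((bop_eq S' (adj S' * P')).1 SE).
  by apply/(gamma_contractionP S' P'); split=> //; apply: relations_gamma_bounded.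
- move=> [/(gamma_contractionP S' P')[_ hb] /uPE uP]; split; first exact/uPE.
  have [U [uU UP UE]] := relations_summand (gamma_bounded_relations hb uP SP).
  exists (U : {linear HH -> HH}); split;
    [exact: ((unitary_opP U).2 uU)|exact: ((commute_opP U P').2 UP)|].
  have aU : adjoint dot U = adj U := adjoint_bop U.
  by rewrite aU; apply: ((bop_eq S' (U + adj U * P')).2 UE).
- move=> [/uPE uP [V [uV cV SE]]].
  pose U : bop HH := mkbop ((@bounded_opP R HH V).1 (let: And3 b _ _ := uV in b)).
  have uU : unitary U := (unitary_opP U).1 uV.
  have UP : GRing.comm U P' := (commute_opP U P').1 cV.
  apply: (@summand_Gamma_unitary _ _ S' P' U) => //.
  have aU : adjoint dot V = adj U := adjoint_bop U.
  by rewrite aU in SE; apply: ((bop_eq S' (U + adj U * P')).1 SE).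
Qed.
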